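(* Let $\{(N_n,B_n)\}_{n=1}^\infty$ be a sequence of admissible pairs in $\mathbb{R}$ with $N_n>0$, satisfying the remainder bounded condition $$\sum_{n=1}^{\infty}\frac{\#B_{n,2}}{\#B_n}<\infty,$$ where $B_{n,1}=B_n\cap\{0,1,\dots,N_n-1\}$ and $B_{n,2}=B_n\setminus B_{n,1}$. Suppose there exists a subsequence $\{B_{n_k}\}_{k=1}^\infty$ such that each $B_{n_k}$ is a general consecutive set with respect to $N_{n_k}$. Then the infinite convolution $$\mu=\delta_{N_1^{-1}B_1}*\delta_{(N_2N_1)^{-1}B_2}*\cdots*\delta_{(N_n\cdots N_2N_1)^{-1}B_n}*\cdots$$ exists and is a spectral measure.
   Context: An admissible pair in $\mathbb{R}$ is a pair $(N,B)$ where $N$ is an integer with $|N|>1$ and $B\subseteq\mathbb{Z}$ is finite with $\#B\ge2$, such that there exists $L\subseteq\mathbb{Z}$ with $\#L=\#B$ for which the matrix $\big[\frac{1}{\sqrt{\#B}}e^{-2\pi i (b/N)\ell}\big]_{b\in B,\ell\in L}$ is unitary. For an admissible pair $(N,B)$, $B$ is a general consecutive set if $B\equiv\{0,1,\dots,\#B-1\}\pmod N$, i.e. the set of residues modulo $N$ of the elements of $B$ is $\{0,1,\dots,\#B-1\}$. For finite $A\subseteq\mathbb{R}$, $\delta_A=\frac{1}{\#A}\sum_{a\in A}\delta_a$; $*$ is convolution. The infinite convolution is the weak limit (if it exists) of $\mu_n=\delta_{N_1^{-1}B_1}*\cdots*\delta_{(N_n\cdots N_1)^{-1}B_n}$. A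 Borel probability measure $\mu$ on $\mathbb{R}$ is spectral if there is a countable $\Lambda\subseteq\mathbb{R}$ such that $\{e^{-2\pi i\lambda x}:\lambda\in\Lambda\}$ is an orthonormal basis of $L^2(\mu)$. *)

(* Defs.v *)
From HB Require Import structures.
From mathcomp Require Import all_boot all_order all_algebra.
From mathcomp Require Import all_classical all_reals all_analysis.
From mathcomp Require complex.
Import complex.ComplexField.
Set Implicit Arguments. Unset Strict Implicit. Unset Printing Implicit Defensive.
Import Order.TTheory GRing.Theory Num.Theory.
Import numFieldNormedType.Exports.
Local Open Scope classical_set_scope.
Local Open Scope ring_scope.

Section Defs.
Variable R : realType.
Local Notation C := (complex.complex R).

Definition expiC (t : R) : C := complex.Complex (cos t) (sin t).

Definition conj_tr m (U : 'M[C]_m) : 'M[C]_m :=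
  \matrix_(i, j) complex.conjc (U j i).

Definition four_mx (N : int) (B L : seq int) (m : nat) : 'M[C]_m :=
  \matrix_(i < m, j < m)
    (complex.Complex (Num.sqrt (m%:R : R))^-1 (0 : R) * expiC (- (2 * pi) * ((B`_i)%:~R / N%:~R) * (L`_j)%:~R)).

Definition admissible (N : int) (B : seq int) : Prop :=
  [/\ 1 < `|N|, uniq B, (2 <= size B)%N &
   exists L : seq int, [/\ uniq L, size L = size B &
     let U := four_mx N B L (size B) in U *m conj_tr U = 1%:M]].

Definition general_consecutive (N : int) (B : seq int) : Prop :=
  [seq (b %% N)%Z | b <- B] =i [seq (Posz i) | i <- iota 0 (size B)].

Definition card_B2 (N : int) (B : seq int) : nat :=
  count (fun b : int => ~~ ((0 <= b) && (b < N))) B.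

(* Products P k = N_1 ... N_k (0-indexed: N 0 = N_1). *)
Definition prodN (N : nat -> int) (k : nat) : R := \prod_(j < k) (N j)%:~R.

(* Atoms of mu_n = delta_{N_1^{-1}B_1} * ... * delta_{(N_n...N_1)^{-1} B_n},
   listed with multiplicity: all sums sum_{j<n} b_j / (N_1...N_{j+1}). *)
Fixpoint atoms (N : nat -> int) (B : nat -> seq int) (n : nat) : seq R :=
  match n with
  | 0 => [:: 0]
  | k.+1 => [seq x + (b%:~R / prodN N k.+1) | x <- atoms N B k, b <- B k]
  end.

Definition int_mu_n (N : nat -> int) (B : nat -> seq int) (n : nat) (f : R -> R) : R :=
  (size (atoms N B n))%:R^-1 * \sum_(x <- atoms N B n) f x.

(* spectral measure: exists countable Lambda with {e_lambda(x)=e^{-2 pi i lambda x}}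
   an orthonormal basis of L^2(mu) (complex-valued functions f = u + i v). *)
Definition spectral (mu : probability R R) : Prop :=
  exists Lambda : set R, countable Lambda /\
  (* orthonormality: <e_l, e_l'> = int e^{-2 pi i (l - l') x} dmu = [l == l'] *)
  (forall l l', Lambda l -> Lambda l' ->
      (\int[mu]_x (cos (2 * pi * (l - l') * x))%:E = (if l == l' then 1 else 0)%:E)%E /\
      (\int[mu]_x (sin (2 * pi * (l - l') * x))%:E = 0)%E) /\
  (* completeness: f = u + i v in L^2(mu) with <f, e_l> = 0 for all l is 0 a.e. *)
  (forall u v : R -> R,
      measurable_fun setT u -> measurable_fun setT v ->
      mu.-integrable setT (fun x => (u x ^+ 2)%:E) ->
      mu.-integrable setT (fun x => (v x ^+ 2)%:E) ->
      (forall l, Lambda l ->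
         (\int[mu]_x (u x * cos (2 * pi * l * x) - v x * sin (2 * pi * l * x))%:E = 0)%E /\
         (\int[mu]_x (u x * sin (2 * pi * l * x) + v x * cos (2 * pi * l * x))%:E = 0)%E) ->
      {ae mu, forall x, u x = 0 /\ v x = 0}).

End Defs.

(* Main.v *)
Require Import Defs.
From HB Require Import structures.
From mathcomp Require Import all_boot all_order all_algebra.
From mathcomp Require Import all_classical all_reals all_analysis.
From mathcomp Require Import measurable_realfun complex.
From mathcomp Require Import ring lra zify.
Set Implicit Arguments. Unset Strict Implicit. Unset Printing Implicit Defensive.
Import Order.TTheory GRing.Theory Num.Theory.
Import numFieldNormedType.Exports.
Local Open Scope classical_set_scope.
Local Open Scope ring_scope.

(** Write [P_n = N_1 ... N_n]; [mu] is the law of [X = sum_n b_n / P_n] with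
    independent uniform digits [b_n in B_n].  By the remainder bounded condition
    and Borel-Cantelli, almost surely only finitely many digits leave
    [{0, ..., N_n - 1}], so the series converges almost surely and dominated
    convergence gives the weak convergence [mu_n -> mu].

    Spectra [L_n] of the single factors combine into spectra [Lambda_n] of
    [mu_n], since [mu_n] only sees frequencies modulo [P_n].  Frequencies are
    always reduced to [-P_n/2, P_n/2]; then [Lambda_n] is increasing, and for
    [l in Lambda_n] the Fourier transform of the rescaled tail of [mu] is needed
    only at [l / P_n] in [-1/2, 1/2].  If [B_{n+1}] is a general consecutive set
    and the tail is almost carried by [[0,1]], the first tail digit is
    equidistributed, which bounds that transform away from 0 uniformly.  Along
    such [n], Parseval's identity for [mu_n] yields, for bounded Lipschitz [g],
      [sum_(l in Lambda_n) |<g, e_l>|^2 >= kappa |g|^2 - o(1)],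
    with [kappa > 0] independent of [g].  If [f] is orthogonal to all [e_l],
    Bessel's inequality for [f - g] gives [kappa |g|^2 <= |f - g|^2 + o(1)], and
    density of bounded Lipschitz functions in [L^2(mu)] forces [f = 0]. *)

(** * Averages over finite lists and complex exponentials *)

Section Average.
Variable K : numFieldType.

(** Repeated entries count with multiplicity, so averaging over [atoms] is integration against a
    finite convolution. *)
Definition avg (T : Type) (s : seq T) (f : T -> K) : K :=
  (size s)%:R^-1 * \sum_(x <- s) f x.

Lemma eq_avg (T : Type) (s : seq T) (f g : T -> K) :
  f =1 g -> avg s f = avg s g.
Proof. by move=> fg; congr (_ * _); apply: eq_bigr. Qed.

Lemma eq_avg_seq (T : eqType) (s : seq T) (f g : T -> K) :
  {in s, f =1 g} -> avg s f = avg s g.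
Proof. by move=> fg; congr (_ * _); apply: eq_big_seq. Qed.

Lemma avgD (T : Type) (s : seq T) (f g : T -> K) :
  avg s (fun x => f x + g x) = avg s f + avg s g.
Proof. by rewrite /avg big_split mulrDr. Qed.

Lemma avgZ (T : Type) (s : seq T) c (f : T -> K) :
  avg s (fun x => c * f x) = c * avg s f.
Proof. by rewrite /avg -mulr_sumr mulrCA. Qed.

Lemma avgZr (T : Type) (s : seq T) c (f : T -> K) :
  avg s (fun x => f x * c) = avg s f * c.
Proof. by rewrite /avg -mulr_suml mulrA. Qed.

Lemma avgN (T : Type) (s : seq T) (f : T -> K) :
  avg s (fun x => - f x) = - avg s f.
Proof. by rewrite /avg sumrN mulrN. Qed.

Lemma avgB (T : Type) (s : seq T) (f g : T -> K) :
  avg s (fun x => f x - g x) = avg s f - avg s g.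
Proof. by rewrite avgD avgN. Qed.

Lemma avg_cst (T : Type) (s : seq T) c : (0 < size s)%N ->
  avg s (fun=> c) = c.
Proof.
move=> s0; rewrite /avg big_const_seq count_predT iter_addr addr0.
by rewrite -[c *+ _]mulr_natl mulrA mulVf ?mul1r// pnatr_eq0 -lt0n.
Qed.

Lemma avg_sum (T : Type) (I : Type) (r : seq I) (s : seq T) (F : I -> T -> K) :
  avg s (fun x => \sum_(i <- r) F i x) = \sum_(i <- r) avg s (F i).
Proof. by rewrite /avg exchange_big/= mulr_sumr. Qed.

Lemma exchange_avg (T U : Type) (s : seq T) (t : seq U) (F : T -> U -> K) :
  avg s (fun x => avg t (F x)) = avg t (fun y => avg s (F^~ y)).
Proof. by rewrite {1}/avg -mulr_sumr exchange_big /avg -mulr_sumr mulrCA. Qed.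

Lemma avg_allpairs (S T U : Type) (g : S -> T -> U) (s : seq S) (t : seq T)
    (f : U -> K) :
  avg [seq g x y | x <- s, y <- t] f = avg s (fun x => avg t (fun y => f (g x y))).
Proof.
by rewrite /avg size_allpairs big_allpairs_dep -mulr_sumr natrM invfM mulrA.
Qed.

Lemma ler_avg (T : eqType) (s : seq T) (f g : T -> K) :
  {in s, forall x, f x <= g x} -> avg s f <= avg s g.
Proof.
move=> fg; apply: ler_wpM2l; first by rewrite invr_ge0 ler0n.
by rewrite !big_seq; apply: ler_sum.
Qed.

Lemma avg_ge0 (T : Type) (s : seq T) (f : T -> K) :
  (forall x, 0 <= f x) -> 0 <= avg s f.
Proof.
by move=> f0; rewrite /avg mulr_ge0 ?invr_ge0 ?ler0n// sumr_ge0.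
Qed.

End Average.

(* The variance of [f] is nonnegative. *)
Lemma avg_sqr_le (K : realFieldType) (T : eqType) (s : seq T) (f : T -> K) :
  avg s f ^+ 2 <= avg s (fun x => f x ^+ 2).
Proof.
have [s0|s0] := posnP (size s).
  by rewrite /avg (size0nil s0) !big_nil !mulr0 expr0n.
have : 0 <= avg s (fun x => (f x - avg s f) ^+ 2).
  by apply: avg_ge0 => x; exact: sqr_ge0.
rewrite (eq_avg _ (g := fun x => f x ^+ 2 - 2 * avg s f * f x + avg s f ^+ 2));
  last by move=> x; ring.
rewrite avgD avgB avgZ avg_cst//; set m := avg s f; set q := avg _ _; lra.
Qed.

Section ComplexExponential.
Variable R : realType.
Local Notation C := (complex R).

Definition nsq (z : C) : R := complex.Re z ^+ 2 + complex.Im z ^+ 2.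

Lemma nsqE z : (nsq z)%:C%C = z * z^*%C.
Proof. by case: z => a b; rewrite /nsq /=; simpc; congr Complex; ring. Qed.

Lemma nsq_ge0 z : 0 <= nsq z.
Proof. by rewrite addr_ge0 ?sqr_ge0. Qed.

Lemma nsqM y z : nsq (y * z) = nsq y * nsq z.
Proof. by case: y z => [a b] [c d]; rewrite /nsq/=; ring. Qed.

Lemma nsq1 : nsq 1 = 1. Proof. by rewrite /nsq/=; ring. Qed.

Lemma nsq_eq0 z : nsq z = 0 -> z = 0.
Proof.
case: z => a b /eqP; rewrite /nsq/= paddr_eq0 ?sqr_ge0// !sqrf_eq0.
by move=> /andP[/eqP -> /eqP ->].
Qed.

(** Twice the difference of the two sides is [nsq (y + 2 * z)]. *)
Lemma nsqD_ge y z : nsq y / 2 - nsq z <= nsq (y + z).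
Proof.
case: y z => [a b] [c d]; rewrite /nsq/=.
have := sqr_ge0 (a + 2 * c); have := sqr_ge0 (b + 2 * d); nra.
Qed.

Lemma Re_sqr_le z : complex.Re z ^+ 2 <= nsq z.
Proof. by rewrite lerDl sqr_ge0. Qed.

Lemma Re_avg (T : Type) (s : seq T) (f : T -> C) :
  complex.Re (avg s f) = avg s (fun x => complex.Re (f x)).
Proof.
rewrite /avg -raddf_sum /= -(rmorph_nat (real_complex R)) -fmorphV /=.
by case: (\sum_(_ <- _) _) => a b /=; rewrite mul0r subr0.
Qed.

Lemma Im_avg (T : Type) (s : seq T) (f : T -> C) :
  complex.Im (avg s f) = avg s (fun x => complex.Im (f x)).
Proof.
rewrite /avg -raddf_sum /= -(rmorph_nat (real_complex R)) -fmorphV /=.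
by case: (\sum_(_ <- _) _) => a b /=; rewrite mul0r addr0.
Qed.

Lemma avg_real (T : Type) (s : seq T) (f : T -> R) :
  avg s (fun x => (f x)%:C%C) = (avg s f)%:C%C.
Proof.
by rewrite /avg rmorphM /= fmorphV rmorph_nat rmorph_sum.
Qed.

Lemma conjM (y z : C) : (y * z)^*%C = y^*%C * z^*%C.
Proof. exact: rmorphM. Qed.

Lemma conj_avg (T : Type) (s : seq T) (f : T -> C) :
  (avg s f)^*%C = avg s (fun x => (f x)^*%C).
Proof. by rewrite /avg rmorphM /= fmorphV rmorph_nat rmorph_sum. Qed.

Lemma nsq_avg_le (T : eqType) (s : seq T) (f : T -> C) :
  nsq (avg s f) <= avg s (fun x => nsq (f x)).
Proof. by rewrite /nsq avgD Re_avg Im_avg lerD ?avg_sqr_le. Qed.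

(** [ev (l * x)] is the conjugate of the character [e_l], so averaging [f x * ev (l * x)] gives the
    coefficient [<f, e_l>]. *)
Definition ev (t : R) : C := expiC (2 * pi * t).

Lemma evD s t : ev (s + t) = ev s * ev t.
Proof. by rewrite /ev /expiC mulrDr cosD sinD; simpc; congr Complex; ring. Qed.

Lemma ev0 : ev 0 = 1.
Proof. by rewrite /ev /expiC mulr0 cos0 sin0. Qed.

Lemma conj_ev t : (ev t)^*%C = ev (- t).
Proof. by rewrite /ev /expiC mulrN cosN sinN. Qed.

Lemma nsq_ev t : nsq (ev t) = 1.
Proof. exact: cos2Dsin2. Qed.

Lemma ev_int (k : int) : ev k%:~R = 1.
Proof.
have evn (n : nat) : ev n%:R = 1.
  elim: n => [|n IH]; first exact: ev0.
  rewrite -addn1 natrD evD IH mul1r /ev /expiC mulr1.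
  by rewrite mulr_natl cos2pi sin2pi.
case: k => n; first exact: evn.
by rewrite NegzE mulrNz -conj_ev evn rmorph1.
Qed.

Lemma ev_addint t (k : int) : ev (t + k%:~R) = ev t.
Proof. by rewrite evD ev_int mulr1. Qed.

End ComplexExponential.

(** * Atoms of the finite convolutions *)

Definition tail (T : Type) (u : nat -> T) (n k : nat) : T := u (n + k)%N.

Section Atoms.
Variables (R : realType) (N : nat -> int) (B : nat -> seq int).
Local Notation P := (prodN R N).

Lemma prodNS n : P n.+1 = P n * (N n)%:~R.
Proof. by rewrite /prodN big_ord_recr. Qed.

Lemma prodN_tail n m : prodN R N (n + m) = P n * prodN R (tail N n) m.
Proof. by rewrite /prodN big_split_ord. Qed.

Lemma avg_atomsS (K : numFieldType) n (f : R -> K) :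
  avg (atoms R N B n.+1) f =
  avg (atoms R N B n) (fun x => avg (B n) (fun b => f (x + b%:~R / P n.+1))).
Proof. exact: avg_allpairs. Qed.

End Atoms.

Section AtomsTheory.
Variables (R : realType) (N : nat -> int) (B : nat -> seq int).
Local Notation P := (prodN R N).

Lemma avg_atoms_add (K : numFieldType) n m (f : R -> K) :
  avg (atoms R N B (n + m)) f =
  avg (atoms R N B n) (fun x =>
    avg (atoms R (tail N n) (tail B n) m) (fun z => f (x + z / P n))).
Proof.
elim: m f => [|m IH] f.
  rewrite addn0; apply: eq_avg => x.
  by rewrite /avg /= big_seq1 invr1 mul1r mul0r addr0.
rewrite addnS avg_atomsS IH; apply: eq_avg => x.
rewrite avg_atomsS; apply: eq_avg => z; apply: eq_avg => b.
by rewrite -addnS prodN_tail invfM mulrDl -addrA [_^-1 * _^-1]mulrC mulrA.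
Qed.

(** Splitting off the first digit instead of the last lets estimates on a tail use properties of its
    leading factor. *)
Lemma avg_atoms_first (K : numFieldType) m (f : R -> K) :
  avg (atoms R N B m.+1) f =
  avg (B 0%N) (fun b => avg (atoms R (tail N 1) (tail B 1) m)
    (fun y => f ((b%:~R + y) / (N 0%N)%:~R))).
Proof.
rewrite -[m.+1]/(1 + m)%N avg_atoms_add avg_atomsS.
rewrite {1}/avg /= big_seq1 invr1 mul1r.
have -> : P 1 = (N 0%N)%:~R by rewrite /prodN big_ord1.
by apply: eq_avg => b; apply: eq_avg => y; rewrite add0r mulrDl.
Qed.

Hypothesis N_neq0 : forall n, N n != 0.

Lemma prodN_neq0 n : P n != 0.
Proof. by apply/prodf_neq0 => i _; rewrite intr_eq0. Qed.

Lemma prodN_atoms_int n x : x \in atoms R N B n ->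
  exists k : int, P n * x = k%:~R.
Proof.
elim: n x => [|n IH] x /=.
  by rewrite inE => /eqP ->; exists 0; rewrite mulr0.
move=> /allpairsP[[y b] /= [/IH[k yk] _ ->]].
exists (k * N n + b); rewrite mulrDr intrD intrM -yk {1}prodNS.
by rewrite [X in _ + X]mulrC divfK ?prodN_neq0// mulrAC.
Qed.

Hypothesis size_B : forall n, (0 < size (B n))%N.

Lemma size_atoms_gt0 n : (0 < size (atoms R N B n))%N.
Proof. by elim: n => //= n IH; rewrite size_allpairs muln_gt0 IH size_B. Qed.

End AtomsTheory.

(** * Spectra of a single factor *)

Section Frame.
Variable R : realType.
Local Notation C := (complex R).

(* [L] is a spectrum of [delta_{B/N}], phrased as Parseval's identity. *)
Definition parseval (N : int) (B L : seq int) : Prop :=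
  forall psi : int -> C,
    \sum_(l <- L) nsq (avg B (fun b => psi b * ev (b%:~R / N%:~R * l%:~R))) =
    avg B (fun b => nsq (psi b)).

Lemma admissible_orthogonal (N : int) (B : seq int) : admissible R N B ->
  exists2 L : seq int, size L = size B &
    forall i j, (i < size B)%N -> (j < size B)%N ->
    \sum_(l <- L) ev (((B`_i)%:~R - (B`_j)%:~R) / N%:~R * l%:~R) =
    ((size B)%:R *+ (i == j) : C).
Proof.
move=> [_ _ B2 [L [_ sL UU]]]; exists L => // i j iB jB.
(* The exponent in [four_mx] is negative, so the entry [(j, i)] of [U U^*] carries the phase
   [b_i - b_j]. *)
have := congr1 (fun M : 'M[C]_(size B) => M (Ordinal jB) (Ordinal iB)) UU.
rewrite !mxE /= -val_eqE /= [j == i]eq_sym => H.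
have B0 : (size B)%:R != 0 :> C by rewrite pnatr_eq0; lia.
apply: (mulfI (invr_neq0 B0)).
rewrite [RHS](_ : _ = (i == j)%:R); last first.
  by case: (i == j); rewrite ?mulr0// mulVf.
rewrite -H (big_nth (0 : int)) sL big_mkord mulr_sumr; apply: eq_bigr => l _.
rewrite !mxE.
have -> : (size B)%:R^-1 = complex.Complex (Num.sqrt (size B)%:R)^-1 0
    * complex.conjc (complex.Complex (Num.sqrt (size B)%:R)^-1 0) :> C.
  simpc; rewrite -invfM -expr2 sqr_sqrtr ?ler0n//.
  by rewrite -(rmorph_nat (real_complex R)) -fmorphV.
set r := complex.Complex _ 0.
have evE t s : expiC (- (2 * pi) * (t / N%:~R) * s) = ev (- (t / N%:~R * s)) :> C.
  by rewrite /ev mulrN mulNr mulNr !mulrA.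
rewrite !evE conjM conj_ev opprK.
rewrite [RHS]mulrACA -evD; congr (_ * ev _).
ring.
Qed.

(** Expanding the squared moduli into double sums over [B] and summing over [L] first leaves only
    the diagonal. Having 0 in [L] will make the lists [spec] increasing. *)
Lemma admissible_parseval (N : int) (B : seq int) : admissible R N B ->
  exists2 L : seq int, 0 \in L & parseval N B L.
Proof.
move=> adm; have [L sL orth] := admissible_orthogonal adm.
have B2 : (2 <= size B)%N by case: adm.
have B0 : (size B)%:R != 0 :> C by rewrite pnatr_eq0; lia.
have parsL : parseval N B L.
  move=> psi; apply: (@complexI R); rewrite rmorph_sum /= -avg_real.
  pose F i j : C := psi B`_i * (psi B`_j)^*%C.
  transitivity (\sum_(l <- L) (size B)%:R^-1 ^+ 2 * \sum_(i < size B)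
      \sum_(j < size B) F i j *
        ev (((B`_i)%:~R - (B`_j)%:~R) / N%:~R * l%:~R)).
    apply: eq_bigr => l _; rewrite nsqE conj_avg /avg mulrACA expr2.
    congr (_ * _); rewrite 2!(big_nth (0 : int)) !big_mkord mulr_suml.
    apply: eq_bigr => i _; rewrite mulr_sumr; apply: eq_bigr => j _.
    rewrite conjM conj_ev mulrACA -evD; congr (_ * ev _).
    by rewrite mulrBl mulrBl.
  rewrite -mulr_sumr exchange_big /avg /= expr2 -mulrA; congr (_ * _).
  rewrite (big_nth (0 : int)) big_mkord mulr_sumr; apply: eq_bigr => i _.
  rewrite exchange_big /= (bigD1 i)//= -mulr_sumr orth// eqxx.
  rewrite big1 => [|j ji]; first by rewrite addr0 mulrCA mulVf// mulr1 nsqE.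
  by rewrite -mulr_sumr orth// eq_sym val_eqE (negPf ji) mulr0.
case: L sL {orth} parsL => [|l0 L] sL parsL; first by move: sL B2 => /= <-.
(* Translating [L] by [- l0] only multiplies [psi] by a unimodular factor, which does not change the
   right-hand side. *)
exists [seq l - l0 | l <- l0 :: L]; first by rewrite /= subrr mem_head.
move=> psi; rewrite big_map.
transitivity (avg B (fun b => nsq (psi b * ev (- (b%:~R / N%:~R * l0%:~R))))).
  rewrite -parsL; apply: eq_bigr => l _; congr nsq; apply: eq_avg => b.
  by rewrite -[RHS]mulrA -evD intrB mulrBr addrC.
by apply: eq_avg => b; rewrite nsqM nsq_ev mulr1.
Qed.

End Frame.

(** * Spectra of the finite convolutions *)

(* The representative of [k] modulo [M] lying in [-M/2, M/2]. *)
Definition symmod (M k : int) : int := ((k + (M %/ 2)%Z) %% M)%Z - (M %/ 2)%Z.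

Definition symrange (M k : int) : bool := - (M %/ 2)%Z <= k < M - (M %/ 2)%Z.

Lemma symmodE (M k : int) : exists q : int, symmod M k = k + q * M.
Proof.
exists (- ((k + (M %/ 2)%Z) %/ M)%Z); rewrite /symmod.
have := divz_eq (k + (M %/ 2)%Z) M.
set h := (M %/ 2)%Z; set q := (_ %/ M)%Z; set r := (_ %% M)%Z => e.
by apply/eqP; rewrite subr_eq mulNr addrAC e addrAC subrr add0r.
Qed.

Lemma symmod_range (M k : int) : 0 < M -> symrange M (symmod M k).
Proof.
move=> M0; rewrite /symrange /symmod.
have := modz_ge0 (k + (M %/ 2)%Z) (lt0r_neq0 M0).
have := ltz_pmod (k + (M %/ 2)%Z) M0.
set h := (M %/ 2)%Z; set r := (_ %% M)%Z; lia.
Qed.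

Lemma symmod_small (M k : int) : symrange M k -> symmod M k = k.
Proof.
rewrite /symrange /symmod => rk; rewrite modz_small ?addrK//.
by move: rk; set h := (M %/ 2)%Z; lia.
Qed.

Lemma symrange_le (M M' k : int) : M <= M' -> symrange M k -> symrange M' k.
Proof. rewrite /symrange; lia. Qed.

Lemma symrange_norm (M k : int) : symrange M k -> 2 * `|k| <= M.
Proof. rewrite /symrange; lia. Qed.

(* A stochastic matrix with unit diagonal is the identity. *)
Lemma uniq_sum1 (K : realFieldType) (T : eqType) (s : seq T) (F : T -> T -> K) :
  (forall x y, 0 <= F x y) -> (forall x, F x x = 1) ->
  {in s, forall x, \sum_(y <- s) F x y = 1} ->
  uniq s /\ {in s &, forall x y, x != y -> F x y = 0}.
Proof.
move=> F0 F1 Fs; split.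
  apply: count_mem_uniq => x.
  have [xs|xs] := boolP (x \in s); last by apply/eqP; rewrite -leqn0 leqNgt -has_count has_pred1.
  have : (0 < count_mem x s)%N by rewrite -has_count has_pred1.
  suff : (count_mem x s <= 1)%N by case: count => [|[]].
  (* Every occurrence of [x] in [s] contributes [F x x = 1] to a row sum equal to 1. *)
  suff : (count_mem x s)%:R <= \sum_(y <- s) F x y by rewrite Fs// lern1.
  rewrite -sum1_count natr_sum big_mkcond /=.
  by apply: ler_sum => y _; case: eqVneq => [->|_]; rewrite ?F1.
move=> x y xs ys xy; apply/eqP; rewrite eq_le F0 andbT.
have := Fs x xs; rewrite (big_rem x)//= F1 -[RHS]addr0 => /addrI rem0.
have yr : y \in rem x s by apply: rem_mem; rewrite 1?eq_sym.
by rewrite -rem0 (big_rem y)//= lerDl sumr_ge0.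
Qed.

Section Spectrum.
Variables (R : realType) (N : nat -> int) (B L : nat -> seq int).
Local Notation C := (complex R).
Local Notation P := (prodN R N).

Definition prodz (n : nat) : int := \prod_(j < n) N j.

(* Keeping every frequency in [-P n / 2, P n / 2] both makes the lists
   increasing and keeps the Fourier transforms of the tails away from 0. *)
Fixpoint spec (n : nat) : seq int :=
  match n with
  | 0 => [:: 0]
  | k.+1 => [seq symmod (prodz k.+1) (l + prodz k * j) | l <- spec k, j <- L k]
  end.

Lemma big_specS (F : int -> R) n : \sum_(l <- spec n.+1) F l =
  \sum_(l <- spec n) \sum_(j <- L n) F (symmod (prodz n.+1) (l + prodz n * j)).
Proof. exact: big_allpairs_dep. Qed.

Hypothesis N_gt0 : forall n, 0 < N n.
Hypothesis L0 : forall n, 0 \in L n.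
Hypothesis parsL : forall n, parseval R (N n) (B n) (L n).

Let N_neq0 n : N n != 0. Proof. exact: lt0r_neq0. Qed.

Lemma prodNE n : P n = (prodz n)%:~R.
Proof. by rewrite /prodN /prodz rmorph_prod. Qed.

Lemma prodzS n : prodz n.+1 = prodz n * N n.
Proof. by rewrite /prodz big_ord_recr. Qed.

Lemma prodz_gt0 n : 0 < prodz n.
Proof. by apply: prodr_gt0. Qed.

Lemma prodN_gt0 n : 0 < P n.
Proof. by rewrite prodNE ltr0z prodz_gt0. Qed.

Lemma spec_range n l : l \in spec n -> symrange (prodz n) l.
Proof.
case: n => [|n]; last by case/allpairsP => ? [_ _ ->]; exact/symmod_range/prodz_gt0.
by rewrite inE => /eqP ->; rewrite /prodz big_ord0.
Qed.

(** Taking the digit frequency 0 gives [l] itself, and [symmod] leaves it alone because the range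
    only grows from [prodz n] to [prodz n.+1]. *)
Lemma spec_subS n : {subset spec n <= spec n.+1}.
Proof.
move=> l ln; apply/allpairsP; exists (l, 0); split => //=.
rewrite mulr0 addr0 symmod_small//; apply: symrange_le (spec_range ln).
by rewrite prodzS ler_peMr ?(ltW (prodz_gt0 n))//; have := N_gt0 n; lia.
Qed.

Lemma spec_sub n m : {subset spec n <= spec (n + m)}.
Proof.
elim: m => [|m IH] l ln; first by rewrite addn0.
by rewrite addnS; apply/spec_subS/IH.
Qed.

(** Since [P n * x] is an integer, the term [P n * j] is invisible to [x] and acts on the new digit
    only, and reduction modulo [P n.+1] is invisible to the whole atom. *)
Lemma ev_spec n x (b l j : int) : x \in atoms R N B n ->
  ev ((symmod (prodz n.+1) (l + prodz n * j))%:~R * (x + b%:~R / P n.+1)) =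
  ev (l%:~R * x) * ev (l%:~R * (b%:~R / P n.+1)) *
  ev (b%:~R / (N n)%:~R * j%:~R) :> C.
Proof.
move=> /(prodN_atoms_int N_neq0)[i xi].
have [q ->] := symmodE (prodz n.+1) (l + prodz n * j).
have P0 := prodN_neq0 R N_neq0 n.
have n0 : (N n)%:~R != 0 :> R by rewrite intr_eq0.
(* With [i = P n * x] and [symmod] adding [q * P n.+1], the exponents differ by [j * i] from the old
   atom and by [q * (i * N n + b)] from the reduction. *)
rewrite -!evD -[RHS](ev_addint _ (j * i + q * (i * N n) + q * b)).
congr ev; rewrite !(intrD, intrM) -xi -!prodNE prodNS.
by field; rewrite n0 P0.
Qed.

(** Induction over the digits: for fixed [l] the sum over [j] is Parseval for the new factor, after
    which the induction hypothesis applies for each fixed digit [b]. *)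
Lemma spec_parseval n (f : R -> C) :
  \sum_(l <- spec n) nsq (avg (atoms R N B n) (fun x => f x * ev (l%:~R * x))) =
  avg (atoms R N B n) (fun x => nsq (f x)).
Proof.
elim: n f => [|n IH] f.
  by rewrite /= /avg !big_seq1 invr1 !mul1r mulr0 ev0 mulr1 /= invr1 mul1r.
rewrite big_specS.
transitivity (\sum_(l <- spec n) avg (B n) (fun b =>
    nsq (avg (atoms R N B n) (fun x => f (x + b%:~R / P n.+1) * ev (l%:~R * x))))).
  apply: eq_bigr => l _; pose psi (b : int) := ev (l%:~R * (b%:~R / P n.+1)) *
    avg (atoms R N B n) (fun x => f (x + b%:~R / P n.+1) * ev (l%:~R * x)).
  transitivity (avg (B n) (fun b => nsq (psi b))); last first.
    by apply: eq_avg => b; rewrite nsqM nsq_ev mul1r.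
  rewrite -parsL; apply: eq_bigr => j _; congr nsq.
  rewrite avg_atomsS exchange_avg; apply: eq_avg => b.
  rewrite /psi -avgZ -avgZr; apply: eq_avg_seq => x xn.
  by rewrite ev_spec//; ring.
rewrite -avg_sum avg_atomsS exchange_avg; apply: eq_avg => b.
exact: IH.
Qed.

Hypothesis size_B : forall n, (0 < size (B n))%N.

Let avg_atoms_cst n (c : R) : avg (atoms R N B n) (fun=> c) = c.
Proof. by rewrite avg_cst// size_atoms_gt0. Qed.

Let sum_spec n l' : \sum_(l <- spec n)
  nsq (avg (atoms R N B n) (fun x => ev ((l%:~R - l'%:~R) * x))) = 1.
Proof.
transitivity (avg (atoms R N B n) (fun x => nsq (ev (- l'%:~R * x)))); last first.
  by rewrite -[RHS](avg_atoms_cst n); apply: eq_avg => x; rewrite nsq_ev.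
rewrite -spec_parseval; apply: eq_bigr => l _; congr nsq; apply: eq_avg => x.
rewrite -evD; congr ev; ring.
Qed.

(** Parseval for the unimodular functions [ev (- l' * x)] says that the squared correlations form a
    matrix with row sums 1 and unit diagonal, which [uniq_sum1] turns into the absence of
    repetitions and orthogonality. *)
Let spec_uniq_orth n : uniq (spec n) /\ {in spec n &, forall l' l, l' != l ->
  nsq (avg (atoms R N B n) (fun x => ev ((l%:~R - l'%:~R) * x))) = 0}.
Proof.
apply: uniq_sum1 => [*|l|l' _]; [exact: nsq_ge0| |exact: sum_spec].
have C0 : (0 < size (atoms R N B n))%N by rewrite size_atoms_gt0.
rewrite (eq_avg _ (g := fun=> 1)) ?avg_cst ?nsq1// => x.
by rewrite subrr mul0r ev0.
Qed.

Lemma spec_uniq n : uniq (spec n).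
Proof. by case: (spec_uniq_orth n). Qed.

Lemma spec_orth n l l' : l \in spec n -> l' \in spec n ->
  avg (atoms R N B n) (fun x => ev ((l%:~R - l'%:~R) * x)) = (l == l')%:R.
Proof.
move=> ln ln'; case: eqVneq => [->|ll'].
  rewrite -[RHS](@avg_cst _ _ (atoms R N B n)) ?size_atoms_gt0//.
  by apply: eq_avg => x; rewrite subrr mul0r ev0.
by apply/nsq_eq0/(spec_uniq_orth n).2; rewrite // eq_sym.
Qed.

(** At level [n + m] the coefficient splits as [A + D]: in [A] the value of [g] is frozen at [x],
    which factors out the Fourier transform of the tail at [l / P n], and [D] collects the
    increments of [g]. By [nsqD_ge] half of [nsq A] survives, and Parseval at level [n] sums both
    parts. *)
Lemma spec_frame_lower n m (c : R) (g : R -> C) :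
  (forall l, l \in spec n ->
    c <= nsq (avg (atoms R (tail N n) (tail B n) m) (fun z => ev (l%:~R / P n * z)))) ->
  c / 2 * avg (atoms R N B n) (fun x => nsq (g x)) -
    avg (atoms R (tail N n) (tail B n) m) (fun z =>
      avg (atoms R N B n) (fun x => nsq (g (x + z / P n) - g x))) <=
  \sum_(l <- spec n) nsq (avg (atoms R N B (n + m)) (fun x => g x * ev (l%:~R * x))).
Proof.
move=> hc; rewrite -spec_parseval mulr_sumr.
under [X in _ - X]eq_avg => z do rewrite -spec_parseval.
rewrite avg_sum -sumrB !big_seq; apply: ler_sum => l ln.
set T := atoms R (tail N n) _ m.
rewrite avg_atoms_add -/T.
pose D := avg T (fun z => ev (l%:~R * (z / P n)) *
  avg (atoms R N B n) (fun x => (g (x + z / P n) - g x) * ev (l%:~R * x))).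
pose A := avg T (fun z => ev (l%:~R / P n * z)) *
  avg (atoms R N B n) (fun x => g x * ev (l%:~R * x)).
have -> : avg (atoms R N B n) (fun x => avg T (fun z =>
    g (x + z / P n) * ev (l%:~R * (x + z / P n)))) = A + D.
  rewrite exchange_avg /A /D -avgZr -avgD; apply: eq_avg => z.
  have -> : l%:~R / P n * z = l%:~R * (z / P n) by rewrite mulrAC mulrA.
  rewrite -mulrDr -avgD -avgZ; apply: eq_avg => x.
  rewrite mulrDr evD; ring.
apply: le_trans (nsqD_ge A D); apply: lerB.
  rewrite [nsq A]nsqM [leLHS]mulrAC ler_pM2r ?invr_gt0//; apply: ler_wpM2r; first exact: nsq_ge0.
  exact: hc.
apply: le_trans (nsq_avg_le _ _) _; apply: ler_avg => z _.
by rewrite nsqM nsq_ev mul1r.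
Qed.

End Spectrum.

(** * Fourier transforms of the tails *)

Definition bad_ratio (R : realType) (N : nat -> int) (B : nat -> seq int)
  (n : nat) : R := (card_B2 (N n) (B n))%:R / (size (B n))%:R.

Lemma bad_ratioE (R : realType) (N : nat -> int) (B : nat -> seq int) n :
  bad_ratio R N B n = avg (B n) (fun b => (~~ (0 <= b < N n))%:R).
Proof.
rewrite /avg mulrC; congr (_ / _).
by rewrite /card_B2 -sum1_count natr_sum big_mkcond; apply: eq_bigr => b _; case: ifP.
Qed.

(** A union bound: [(b + y) / N] stays in [[0, 1]] when [y] does and [0 <= b < N], so an atom can
    leave the unit interval only through some digit outside its range. *)
Lemma avg_tail_bad (R : realType) (N : nat -> int) (B : nat -> seq int) m :
  (forall n, 0 < N n) -> (forall n, (0 < size (B n))%N) ->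
  avg (atoms R N B m) (fun z => (~~ (0 <= z <= 1))%:R) <=
  \sum_(j < m) bad_ratio R N B j.
Proof.
elim: m N B => [|m IH] N B N0 B0.
  by rewrite big_ord0 /avg big_seq1 lexx ler01 mulr0.
rewrite avg_atoms_first big_ord_recl bad_ratioE.
pose T := atoms R (tail N 1) (tail B 1) m.
have T0 : (0 < size T)%N by apply: size_atoms_gt0 => n; exact: B0.
apply: (@le_trans _ _ (avg (B 0) (fun b => (~~ (0 <= b < N 0%N))%:R +
    avg T (fun y => (~~ (0 <= y <= 1))%:R)))).
  apply: ler_avg => b _; rewrite -[X in _ <= X + _](@avg_cst _ _ T)// -avgD.
  apply: ler_avg => y _; have [/andP[b0 bN]|_] := boolP (0 <= b < N 0%N); last first.
    by case: (0 <= y <= 1); case: (0 <= _ / _ <= 1); rewrite /= ?mulr0n ?mulr1n; lra.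
  have [/andP[y0 y1]|_] := boolP (0 <= y <= 1); last first.
    by case: (0 <= _ / _ <= 1); rewrite /= ?mulr0n ?mulr1n; lra.
  have n0 : 0 < (N 0%N)%:~R :> R by rewrite ltr0z.
  have bN' : b%:~R + 1 <= (N 0%N)%:~R :> R.
    by rewrite -[1 in leLHS]/(1%:~R) -intrD ler_int; lia.
  have bR : 0 <= b%:~R :> R by rewrite ler0z.
  have -> : 0 <= (b%:~R + y) / (N 0%N)%:~R <= 1.
    by apply/andP; split; [apply: divr_ge0; lra|rewrite ler_pdivrMr//; lra].
  by rewrite addr0.
rewrite avgD avg_cst// lerD2l; apply: IH => n; [exact: N0|exact: B0].
Qed.

Lemma sum_iota_sqr (K : realFieldType) (M : nat) (a : K) :
  \sum_(i <- iota 0 M) (i%:R + a) ^+ 2 =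
  M%:R * (a ^+ 2 + a * (M%:R - 1) + (M%:R - 1) * (2 * M%:R - 1) / 6).
Proof.
elim: M => [|M IH]; first by rewrite big_nil mul0r.
by rewrite -addn1 iotaD big_cat big_seq1 IH add0n natrD /=; field.
Qed.

(** Equality of residue sets suffices: the target list has [size B] distinct entries, so no two
    entries of [B] can share a residue. *)
Lemma general_consecutive_perm (N : int) (B : seq int) :
  general_consecutive N B ->
  perm_eq [seq (b %% N)%Z | b <- B] [seq Posz i | i <- iota 0 (size B)].
Proof.
move=> gcB; have u : uniq [seq Posz i | i <- iota 0 (size B)].
  by rewrite map_inj_uniq ?iota_uniq// => i j [].
by apply: uniq_perm => //; rewrite (eq_uniq _ gcB)// !size_map size_iota.
Qed.

Lemma general_consecutive_size (N : int) (B : seq int) : 0 < N ->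
  (0 < size B)%N -> general_consecutive N B -> (size B)%:Z <= N.
Proof.
move=> N0 B0 gcB; have : Posz (size B).-1 \in [seq (b %% N)%Z | b <- B].
  by rewrite gcB map_f// mem_iota add0n /= prednK.
by case/mapP => b _; have := ltz_pmod b N0; lia.
Qed.

(** With [M = size B], the mean square equals [((y - 1/2)^2 + (M^2 - 1)/12) / N^2]. Since [M <= N]
    and [(y - 1/2)^2 <= 1/4], it is at most [1/12 + 1/(6 M^2)], which is [1/8] in the worst case
    [M = 2]. *)
Lemma avg_general_consecutive (K : realFieldType) (N : int) (B : seq int) (y : K) :
  0 < N -> (2 <= size B)%N -> general_consecutive N B -> 0 <= y <= 1 ->
  avg B (fun b => (((b %% N)%Z%:~R + y) / N%:~R - (size B)%:R / (2 * N%:~R)) ^+ 2)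
  <= 1 / 8.
Proof.
move=> N0 B2 gcB /andP[y0 y1]; set M := (size B)%:R : K.
have n0 : 0 < N%:~R :> K by rewrite ltr0z.
have M2 : 2 <= M by rewrite ler_nat.
have MN : M <= N%:~R.
  by rewrite -[M]/((Posz (size B))%:~R) ler_int general_consecutive_size// ltnW.
rewrite /avg -/M -(big_map (fun b => (b %% N)%Z) xpredT (fun b : int =>
  ((b%:~R + y) / N%:~R - M / (2 * N%:~R)) ^+ 2)).
rewrite (perm_big _ (general_consecutive_perm gcB)) big_map /=.
rewrite (eq_bigr (fun i => (N%:~R ^+ 2)^-1 * (i%:R + (y - M / 2)) ^+ 2)); last first.
  by move=> i _; rewrite -[i%:~R]/(i%:R); field; rewrite gt_eqF.
rewrite -mulr_sumr sum_iota_sqr -/M mulrCA mulKf ?gt_eqF//; last by lra.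
rewrite mulrC ler_pdivrMr ?exprn_gt0//.
nra.
Qed.

Section TailFourier.
Variable R : realType.

Lemma sqr_sin_le (x : R) : sin x ^+ 2 <= x ^+ 2.
Proof.
wlog x0 : x / 0 <= x => [H|].
  by case: (leP 0 x) => [|/ltW] x0; [|rewrite -[x]opprK sinN sqrrN [leRHS]sqrrN];
     apply: H; rewrite ?oppr_ge0.
have [|c _] := MVT_segment x0 (fun z _ => is_derive_sin z).
  by apply: continuous_subspaceT => z; exact: continuous_sin.
by rewrite sin0 !subr0 => ->; rewrite exprMn ler_piMl ?sqr_ge0.
Qed.

Lemma cos_ge_sqr (x : R) : 1 - x ^+ 2 / 2 <= cos x.
Proof.
have -> : x = (x / 2) *+ 2 by rewrite -mulr_natr divfK.
set y := x / 2; rewrite cos_mulr2n cos2sin2 !mulr2n.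
have := sqr_sin_le y; set S := sin y ^+ 2 => Sy.
have -> : (y + y) ^+ 2 / 2 = 2 * y ^+ 2 by field.
lra.
Qed.

(* [pi ^ 2 / 16] is half of [(2 pi s) ^ 2 <= pi ^ 2] times the bound [1 / 8] of
   [avg_general_consecutive]. *)
Definition pigap : R := 1 - pi ^+ 2 / 16.

Lemma pigap_gt0 : 0 < pigap.
Proof.
have := @pihalf_lt2 R; have := @pi_gt0 R; rewrite /pigap => p0 p4.
by rewrite subr_gt0 ltr_pdivrMr// mul1r; nra.
Qed.

(* The first digit is equidistributed over [0, #B / N] modulo an error of one
   cell, so the tail measure stays close to its center in quadratic mean. *)
Lemma tail_fourier_lower (N : nat -> int) (B : nat -> seq int) m (s : R) :
  (forall n, 0 < N n) -> (forall n, (2 <= size (B n))%N) ->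
  general_consecutive (N 0) (B 0) -> `|s| <= 1 / 2 ->
  \sum_(j < m.+1) bad_ratio R N B j <= pigap / 4 ->
  pigap ^+ 2 / 4 <= nsq (avg (atoms R N B m.+1) (fun z => ev (s * z))).
Proof.
move=> N0 B2 gcB s2 bad.
have B0 n : (0 < size (B n))%N by apply: leq_trans (B2 n).
set M := (size (B 0))%:R : R; set n0 := (N 0)%:~R : R.
pose c := M / (2 * n0); pose T := atoms R (tail N 1) (tail B 1) m.
have T0 : (0 < size T)%N by apply: size_atoms_gt0 => n; exact: B0.
(* [res] and [clip] agree with [b] and [y] on good digits and good tails, and replace the others by
   values to which the variance bound still applies. *)
pose res b : R := (b %% N 0%N)%Z%:~R.
pose clip (y : R) := if 0 <= y <= 1 then y else 0.
have clip01 y : 0 <= clip y <= 1 by rewrite /clip; case: ifP; rewrite ?lexx ?ler01.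
have s4 : (2 * pi * s) ^+ 2 <= pi ^+ 2.
  have -> : (2 * pi * s) ^+ 2 = pi ^+ 2 * (4 * `|s| ^+ 2).
    by rewrite real_normK ?num_real//; ring.
  rewrite ler_piMr ?sqr_ge0//; have := normr_ge0 s; nra.
(* On a bad digit or tail the loss 2 drops the left side to at most [-1], below any cosine. *)
have pw b y : 1 - (2 * pi * s) ^+ 2 / 2 * ((res b + clip y) / n0 - c) ^+ 2
    - 2 * (~~ (0 <= b < N 0))%:R - 2 * (~~ (0 <= y <= 1))%:R <=
    cos (2 * pi * s * ((b%:~R + y) / n0 - c)).
  have := cos_ge_sqr (2 * pi * s * ((res b + clip y) / n0 - c)).
  have := cos_geN1 (2 * pi * s * ((b%:~R + y) / n0 - c)).
  set q := (res b + clip y) / n0 - c; set k := 2 * pi * s.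
  have -> : (k * q) ^+ 2 / 2 = k ^+ 2 / 2 * q ^+ 2 by field.
  have sq0 : 0 <= k ^+ 2 / 2 * q ^+ 2.
    by rewrite mulr_ge0 ?divr_ge0 ?sqr_ge0.
  have [bN|_] := boolP (0 <= b < N 0); last first.
    by case: (0 <= y <= 1); rewrite /= ?mulr0n ?mulr1n; lra.
  have [y1|_] := boolP (0 <= y <= 1); last first.
    by rewrite /= mulr0n mulr1n; lra.
  by rewrite /q /res /clip y1 modz_small//= mulr0n; lra.
(* [1 - (pi ^ 2 / 2) * (1 / 8)] is [pigap], and the bad digits cost at most twice [pigap / 4]. *)
have Re_ge : pigap / 2 <=
    avg (atoms R N B m.+1) (fun z => cos (2 * pi * s * (z - c))).
  rewrite avg_atoms_first -/T; apply: le_trans (ler_avg (fun b _ =>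
    ler_avg (fun y _ => pw b y))).
  have -> : avg (B 0) (fun b => avg T (fun y =>
      1 - (2 * pi * s) ^+ 2 / 2 * ((res b + clip y) / n0 - c) ^+ 2
      - 2 * (~~ (0 <= b < N 0))%:R - 2 * (~~ (0 <= y <= 1))%:R)) =
      1 - (2 * pi * s) ^+ 2 / 2 *
        avg T (fun y => avg (B 0) (fun b => ((res b + clip y) / n0 - c) ^+ 2))
      - 2 * bad_ratio R N B 0 - 2 * avg T (fun y => (~~ (0 <= y <= 1))%:R).
    rewrite bad_ratioE exchange_avg; transitivity (avg T (fun y =>
      1 - (2 * pi * s) ^+ 2 / 2 *
        avg (B 0) (fun b => ((res b + clip y) / n0 - c) ^+ 2)
      - 2 * avg (B 0) (fun b => (~~ (0 <= b < N 0))%:R)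
      - 2 * (~~ (0 <= y <= 1))%:R)).
      by apply: eq_avg => y; rewrite !avgB !avgZ !avg_cst.
    by rewrite !avgB !avgZ !avg_cst.
  have q1 : avg T (fun y =>
      avg (B 0) (fun b => ((res b + clip y) / n0 - c) ^+ 2)) <= 1 / 8.
    rewrite -(@avg_cst _ _ T (1 / 8))//; apply: ler_avg => y _.
    exact: avg_general_consecutive.
  have q0 : 0 <= avg T (fun y =>
      avg (B 0) (fun b => ((res b + clip y) / n0 - c) ^+ 2)).
    by apply: avg_ge0 => y; apply: avg_ge0 => b; exact: sqr_ge0.
  have bT : avg T (fun y => (~~ (0 <= y <= 1))%:R) <=
      \sum_(j < m) bad_ratio R (tail N 1) (tail B 1) j.
    by apply: avg_tail_bad => n; [exact: N0|exact: B0].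
  move: bad; rewrite big_ord_recl.
  have -> : \sum_(i < m) bad_ratio R N B (lift ord0 i) =
    \sum_(j < m) bad_ratio R (tail N 1) (tail B 1) j by [].
  move: q1 q0 bT s4 pigap_gt0; rewrite /pigap.
  set Q := avg T _; set S := \sum_(_ < _) _; set W := avg T _.
  set V := _ ^+ 2; set U := pi ^+ 2; set r := bad_ratio _ _ _ _.
  move=> q1 q0 bT s4 g0 bad.
  have : V / 2 * Q <= U / 2 * (1 / 8).
    have : V * Q <= U * Q by exact: ler_wpM2r.
    have : U * Q <= U * (1 / 8) by rewrite ler_wpM2l ?sqr_ge0.
    lra.
  lra.
(* Recentering at [c] multiplies the average by a number of modulus 1. *)
have -> : nsq (avg (atoms R N B m.+1) (fun z => ev (s * z))) =
    nsq (avg (atoms R N B m.+1) (fun z => ev (s * (z - c)))).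
  rewrite -[LHS]mul1r -[X in X * _ = _](nsq_ev (- (s * c))) -nsqM -avgZ.
  by congr nsq; apply: eq_avg => z; rewrite -evD; congr ev; ring.
apply: le_trans (Re_sqr_le _); rewrite Re_avg.
have -> : avg (atoms R N B m.+1) (fun z => complex.Re (ev (s * (z - c)))) =
    avg (atoms R N B m.+1) (fun z => cos (2 * pi * s * (z - c))).
  by apply: eq_avg => z; rewrite /ev /= mulrA.
by have := pigap_gt0; nra.
Qed.

End TailFourier.

(** * A uniform lower frame bound *)

Section BoundedContinuous.
Variable R : realType.

Definition bdcont (f : R -> R) : Prop :=
  continuous f /\ exists M : R, forall x, `|f x| <= M.

Lemma bdcont_cst c : bdcont (fun=> c).
Proof. by split; [exact: cst_continuous|exists `|c|]. Qed.

Lemma bdcontD f g : bdcont f -> bdcont g -> bdcont (fun x => f x + g x).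
Proof.
move=> [cf [M fM]] [cg [K gK]]; split; first by move=> x; apply: cvgD; [exact: cf|exact: cg].
by exists (M + K) => x; rewrite (le_trans (ler_normD _ _))// lerD.
Qed.

Lemma bdcontM f g : bdcont f -> bdcont g -> bdcont (fun x => f x * g x).
Proof.
move=> [cf [M fM]] [cg [K gK]]; split; first by move=> x; apply: cvgM; [exact: cf|exact: cg].
by exists (M * K) => x; rewrite normrM ler_pM.
Qed.

Lemma bdcontN f : bdcont f -> bdcont (fun x => - f x).
Proof.
move=> [cf [M fM]]; split; first by move=> x; apply: cvgN; exact: cf.
by exists M => x; rewrite normrN.
Qed.

Lemma bdcontB f g : bdcont f -> bdcont g -> bdcont (fun x => f x - g x).
Proof. by move=> bf bg; apply: bdcontD => //; exact: bdcontN. Qed.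

Lemma bdcontX2 f : bdcont f -> bdcont (fun x => f x ^+ 2).
Proof. exact: (fun bf => bdcontM bf bf). Qed.

Lemma bdcont_sum (I : Type) (s : seq I) (F : I -> R -> R) :
  (forall i, bdcont (F i)) -> bdcont (fun x => \sum_(i <- s) F i x).
Proof.
move=> bF; elim: s => [|i s IH].
  by under eq_fun do rewrite big_nil; exact: bdcont_cst.
by under eq_fun do rewrite big_cons; exact: bdcontD.
Qed.

Lemma bdcont_cos l : bdcont (fun x => cos (2 * pi * l * x)).
Proof.
split; last by exists 1 => x; exact: cos_max.
move=> x; apply: continuous_comp; last exact: continuous_cos.
by apply: cvgM; [exact: cvg_cst|exact: cvg_id].
Qed.

Lemma bdcont_sin l : bdcont (fun x => sin (2 * pi * l * x)).
Proof.
split; last by exists 1 => x; exact: sin_max.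
move=> x; apply: continuous_comp; last exact: continuous_sin.
by apply: cvgM; [exact: cvg_cst|exact: cvg_id].
Qed.

(** Test functions for the frame bound: the Lipschitz constant controls small shifts by the tail,
    the bound controls the rare large ones. *)
Definition bdlip (f : R -> R) : Prop :=
  exists M K : R, (forall x y, `|f x - f y| <= M * `|x - y|) /\
                  (forall x, `|f x| <= K).

Lemma bdlip_bdcont f : bdlip f -> bdcont f.
Proof.
move=> [M [K [fM fK]]]; split; last by exists K.
move=> x; apply/cvgrPdist_le => e e0.
have M0 : 0 < `|M| + 1 by rewrite ltr_wpDl.
near=> y; apply: (le_trans (fM _ _)).
apply: (@le_trans _ _ ((`|M| + 1) * `|x - y|)).
  by rewrite ler_wpM2r// (le_trans (ler_norm _))// lerDl.
rewrite mulrC -ler_pdivlMr//.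
by near: y; apply: cvgr_dist_le; [exact: cvg_id|rewrite divr_gt0].
Unshelve. all: by end_near. Qed.

Variable mu : probability R R.

Lemma bdcont_measurable f : bdcont f -> measurable_fun setT f.
Proof. by case=> cf _; exact: continuous_measurable_fun. Qed.

Lemma bdcont_bounded f : bdcont f -> [bounded f x | x in setT].
Proof.
by move=> [_ [M fM]]; exists M; split; [exact: num_real|move=> K MK x _ /=; rewrite (le_trans (fM x))// ltW].
Qed.

Lemma bdcont_integrable f : bdcont f -> mu.-integrable setT (EFin \o f).
Proof.
move=> bf; apply: measurable_bounded_integrable => //.
- by rewrite (le_lt_trans (probability_le1 mu measurableT))// ltry.
- exact: bdcont_measurable.
- exact: bdcont_bounded.
Qed.

Lemma integrable_bdcontM f g : mu.-integrable setT (EFin \o f) -> bdcont g ->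
  mu.-integrable setT (EFin \o (fun x => f x * g x)).
Proof.
move=> fi bg.
exact: (integrableMl measurableT fi (bdcont_measurable bg) (bdcont_bounded bg)).
Qed.

End BoundedContinuous.

(** * Passing the frame bound from the finite convolutions to [mu] *)

Section WeakLimit.
Variables (R : realType) (N : nat -> int) (B L : nat -> seq int).
Variable mu : probability R R.
Local Notation C := (complex R).
Local Notation P := (prodN R N).
Local Notation "'I' f" := (Rintegral mu setT f) (at level 10, f at level 9).

Definition weak_limit : Prop := forall f : R -> R, bdcont f ->
  (fun n => avg (atoms R N B n) f) @ \oo --> Rintegral mu setT f.

Hypothesis N_ge2 : forall n, 2 <= N n.
Hypothesis size_B : forall n, (2 <= size (B n))%N.
Hypothesis parsL : forall n, parseval R (N n) (B n) (L n).
Hypothesis cvg_bad : exists l : R, series (bad_ratio R N B) @ \oo --> l.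
Hypothesis muW : weak_limit.

Let N_gt0 n : 0 < N n. Proof. exact: lt_le_trans (N_ge2 n). Qed.
Let B0 n : (0 < size (B n))%N. Proof. exact: leq_trans (size_B n). Qed.

Lemma bad_ratio_ge0 n : 0 <= bad_ratio R N B n.
Proof. by rewrite divr_ge0. Qed.

Lemma bad_tail_small (e : R) : 0 < e -> \forall n \near \oo, forall m,
  \sum_(j < m) bad_ratio R (tail N n) (tail B n) j <= e.
Proof.
move=> e0; have [l sl] := cvg_bad.
have nd : nondecreasing_seq (series (bad_ratio R N B)).
  by apply: nondecreasing_series => n _ _; exact: bad_ratio_ge0.
near=> n => m.
have ln : l - e <= series (bad_ratio R N B) n.
  by near: n; apply: (cvgr_ge l sl); rewrite gtrBl.
have nml : series (bad_ratio R N B) (n + m)%N <= l.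
  have <- : lim (series (bad_ratio R N B) @ \oo) = l by exact: cvg_lim.
  by apply: nondecreasing_cvgn_le => //; apply/cvg_ex; exists l.
have : series (bad_ratio R N B) (n + m)%N = series (bad_ratio R N B) n +
    \sum_(j < m) bad_ratio R (tail N n) (tail B n) j.
  rewrite /series /= (big_cat_nat _ (n := n))//= ?leq_addr//; congr (_ + _).
  by rewrite -{1}[n]add0n big_addn addKn big_mkord; apply: eq_bigr => j _; rewrite addnC.
lra.
Unshelve. all: by end_near. Qed.

Lemma prodN_ge n : n.+1%:R <= P n.
Proof.
elim: n => [|n IH]; first by rewrite /prodN big_ord0.
rewrite prodNS; have : 2 <= (N n)%:~R :> R by rewrite -[2]/(2%:~R) ler_int.
by rewrite -[n.+2]addn1 -[n.+1]addn1 natrD in IH *; have := ler0n R n; rewrite natrD; nra.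
Qed.

Lemma prodN_inv_small (e : R) : 0 < e -> \forall n \near \oo, (P n)^-1 <= e.
Proof.
move=> e0; near=> n; have : harmonic n <= e by near: n; exact: (cvgr_le 0 (@cvg_harmonic R)).
apply: le_trans; rewrite /harmonic /= lef_pV2 ?posrE ?ltr0n ?prodN_ge//.
exact: lt_le_trans (prodN_ge n).
Unshelve. all: by end_near. Qed.

(** A tail [z] in [[0, 1]] moves [x] by at most [1 / P n], giving [M / P n ^ 2 <= M / P n]; for
    other [z] the bound [K] is paid, with frequency controlled by [avg_tail_bad]. *)
Lemma tail_increment_le n m (g : R -> C) (M K : R) :
  (forall x y, nsq (g x - g y) <= M * (x - y) ^+ 2) -> 0 <= M ->
  (forall x y, nsq (g x - g y) <= K) -> 0 <= K ->
  avg (atoms R (tail N n) (tail B n) m) (fun z =>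
    avg (atoms R N B n) (fun x => nsq (g (x + z / P n) - g x))) <=
  M * (P n)^-1 + K * \sum_(j < m) bad_ratio R (tail N n) (tail B n) j.
Proof.
move=> gM M0 gK K0; set T := atoms R (tail N n) _ m.
have T0 : (0 < size T)%N by apply: size_atoms_gt0 => k; exact: B0.
apply: (@le_trans _ _ (M * (P n)^-1 + K * avg T (fun z => (~~ (0 <= z <= 1))%:R))); last first.
  rewrite lerD2l ler_wpM2l//; apply: avg_tail_bad => k; [exact: N_gt0|exact: B0].
rewrite -(@avg_cst _ _ T (M / P n))// -avgZ -avgD; apply: ler_avg => z _.
rewrite -[leRHS](@avg_cst _ _ (atoms R N B n)) ?size_atoms_gt0//; apply: ler_avg => x _.
have P1 : 1 <= P n by apply: le_trans (prodN_ge n); rewrite ler1n.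
have P0 : 0 < P n by exact: lt_le_trans P1.
have [/andP[z0 z1]|_] := boolP (0 <= z <= 1); last first.
  by rewrite mulr1 (le_trans (gK _ _))// lerDr divr_ge0// ltW.
rewrite mulr0 addr0 (le_trans (gM _ _))// ler_wpM2l// addrC addKr exprMn.
rewrite -[leRHS]mul1r ler_pM ?sqr_ge0 ?exprn_ile1//.
by rewrite expr2 ler_piMl ?invr_ge0 ?invf_le1// ltW.
Qed.

Hypothesis gc_often : forall n, exists2 k, (n <= k)%N & general_consecutive (N k) (B k).

(** Half of the lower bound [pigap ^ 2 / 4] for the transforms of the tails; the other half is lost
    in [spec_frame_lower]. *)
Let kappa : R := pigap R ^+ 2 / 8.

Lemma cvg_avg_tail n f : bdcont f ->
  (fun m => avg (atoms R N B (n + m)) f) @ \oo --> I f.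
Proof.
move=> bf; have := muW bf; rewrite -(cvg_shiftn n).
by under eq_fun do rewrite addnC.
Qed.

(** A late [n] with [B n] consecutive is fixed first, leaving three errors of size [e / 3]: the
    convergence of the squared norm of [g], the shifts by [1 / P n] and the bad tails. Then the
    order of the convolution tends to infinity; the sum over [spec N L n] is finite, so weak
    convergence applies to each coefficient. *)
Lemma frame_limit (g1 g2 : R -> R) (e : R) : bdlip g1 -> bdlip g2 -> 0 < e ->
  exists n, kappa * I (fun x => g1 x ^+ 2 + g2 x ^+ 2) - e <=
  \sum_(l <- spec N L n)
    (I (fun x => g1 x * cos (2 * pi * l%:~R * x) - g2 x * sin (2 * pi * l%:~R * x)) ^+ 2 +
     I (fun x => g1 x * sin (2 * pi * l%:~R * x) + g2 x * cos (2 * pi * l%:~R * x)) ^+ 2).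
Proof.
move=> lip1 lip2 e0; have b1 := bdlip_bdcont lip1; have b2 := bdlip_bdcont lip2.
have [M1 [K1 [gM1 gK1]]] := lip1; have [M2 [K2 [gM2 gK2]]] := lip2.
pose M := M1 ^+ 2 + M2 ^+ 2; pose K := 4 * K1 ^+ 2 + 4 * K2 ^+ 2.
pose g x : C := complex.Complex (g1 x) (g2 x).
have M0 : 0 <= M by rewrite addr_ge0 ?sqr_ge0.
have K0 : 0 <= K by apply: addr_ge0; apply: mulr_ge0; rewrite ?sqr_ge0 ?ler0n.
have gM x y : nsq (g x - g y) <= M * (x - y) ^+ 2.
  rewrite /nsq /= mulrDl -[(x - y) ^+ 2]real_normK ?num_real// -!exprMn.
  by rewrite -[(g1 x - _) ^+ 2]real_normK ?num_real// -[(g2 x - _) ^+ 2]real_normK ?num_real//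
    lerD// ler_pXn2r ?nnegrE// (le_trans (normr_ge0 _) (gM1 x y), le_trans (normr_ge0 _) (gM2 x y)).
have gK x y : nsq (g x - g y) <= K.
  have := gK1 x; have := gK1 y; have := gK2 x; have := gK2 y.
  by rewrite /nsq /= /K !ler_norml => /andP[? ?] /andP[? ?] /andP[? ?] /andP[? ?]; nra.
pose G := I (fun x => g1 x ^+ 2 + g2 x ^+ 2).
have bG : bdcont (fun x => g1 x ^+ 2 + g2 x ^+ 2) by apply: bdcontD; exact: bdcontX2.
have e3 : 0 < e / 3 by rewrite divr_gt0.
(* Dividing by [M + 1] and [K + 1] keeps the thresholds meaningful when [M] or [K] is 0. *)
have M1' : 0 < e / 3 / (M + 1) by apply: divr_gt0 => //; exact: ltr_wpDl.
have K1' : 0 < e / 3 / (K + 1) by apply: divr_gt0 => //; exact: ltr_wpDl.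
have p4 : 0 < pigap R / 4 by rewrite divr_gt0// pigap_gt0.
have [n0 _ hn0] : \forall n \near \oo,
    [/\ G - e / 3 <= avg (atoms R N B n) (fun x => g1 x ^+ 2 + g2 x ^+ 2),
        (P n)^-1 <= e / 3 / (M + 1),
        forall m, \sum_(j < m) bad_ratio R (tail N n) (tail B n) j <= e / 3 / (K + 1) &
        forall m, \sum_(j < m) bad_ratio R (tail N n) (tail B n) j <= pigap R / 4].
  near=> n; split; near: n.
  - by apply: (cvgr_ge G (muW bG)); rewrite gtrBl.
  - exact: prodN_inv_small.
  - exact: bad_tail_small.
  - exact: bad_tail_small.
have [n n0n gcn] := gc_often n0; have [hG hP hK hp] := hn0 n n0n.
exists n.
(* The tail has [m.+1] digits so that it contains the consecutive factor [B n]; the frequency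
   [l / P n] has modulus at most [1 / 2] by [spec_range]. *)
have lower m : kappa * G - e <= \sum_(l <- spec N L n)
    nsq (avg (atoms R N B (n + m.+1)) (fun x => g x * ev (l%:~R * x))).
  apply: le_trans (spec_frame_lower N_gt0 parsL g (c := pigap R ^+ 2 / 4) _); last first.
    move=> l ln; apply: tail_fourier_lower => //.
    - by move=> k; exact: N_gt0.
    - by move=> k; exact: size_B.
    - by rewrite /tail addn0.
    have := symrange_norm (spec_range N_gt0 ln).
    rewrite normrM normfV (prodNE R N) -!intr_norm.
    have p0 := prodz_gt0 N_gt0 n; rewrite (gtr0_norm p0) ler_pdivrMr ?ltr0z//.
    by rewrite -(ler_int R) intrM => ?; lra.
  have := tail_increment_le n m.+1 gM M0 gK K0.
  have -> : avg (atoms R N B n) (fun x => nsq (g x)) =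
    avg (atoms R N B n) (fun x => g1 x ^+ 2 + g2 x ^+ 2) by [].
  move: hG; set A := avg _ _; set D := avg _ _; move=> hG.
  have hM : M * (P n)^-1 <= e / 3.
    have -> : e / 3 = (M + 1) * (e / 3 / (M + 1)).
      by rewrite [RHS]mulrC divfK// gt_eqF// ltr_wpDl.
    by rewrite ler_pM// ?lerDl// invr_ge0 ltW// prodN_gt0.
  have {}hK : K * (\sum_(j < m.+1) bad_ratio R (tail N n) (tail B n) j) <= e / 3.
    have -> : e / 3 = (K + 1) * (e / 3 / (K + 1)).
      by rewrite [RHS]mulrC divfK// gt_eqF// ltr_wpDl.
    by rewrite ler_pM// ?lerDl// sumr_ge0// => j _; rewrite divr_ge0.
  have k0 : 0 <= kappa by rewrite divr_ge0 ?sqr_ge0.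
  have k1 : kappa <= 1.
    have := pigap_gt0 R; have : pigap R <= 1 by rewrite gerBl divr_ge0 ?sqr_ge0.
    by rewrite /kappa => *; nra.
  have -> : pigap R ^+ 2 / 4 / 2 = kappa by rewrite /kappa; field.
  have : kappa * (G - e / 3) <= kappa * A by rewrite ler_wpM2l.
  have : kappa * (e / 3) <= e / 3 by rewrite ler_piMl// ltW.
  lra.
suff lim_lower : (fun m => \sum_(l <- spec N L n)
    nsq (avg (atoms R N B (n + m.+1)) (fun x => g x * ev (l%:~R * x)))) @ \oo -->
    \sum_(l <- spec N L n)
    (I (fun x => g1 x * cos (2 * pi * l%:~R * x) - g2 x * sin (2 * pi * l%:~R * x)) ^+ 2 +
     I (fun x => g1 x * sin (2 * pi * l%:~R * x) + g2 x * cos (2 * pi * l%:~R * x)) ^+ 2).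
  apply: (ler_cvg_to (cvg_cst (kappa * G - e)) lim_lower).
  by near=> m; exact: lower.
apply: cvg_big => [|l _]; first exact: add_continuous.
have cs := bdcont_cos (l%:~R : R); have sn := bdcont_sin (l%:~R : R).
have cvg_tailS f : bdcont f ->
    (fun m => avg (atoms R N B (n + m.+1)) f) @ \oo --> I f.
  by move=> /(cvg_avg_tail n.+1); under eq_fun do rewrite addSnnS.
have cvg_sqr (u : nat -> R) (a : R) : u @ \oo --> a ->
    (fun m => u m ^+ 2) @ \oo --> a ^+ 2.
  by move=> ua; exact: (cvgM ua ua).
rewrite /nsq; apply: cvgD.
  apply: cvg_sqr; rewrite [X in X @ _](_ : _ = fun m => avg (atoms R N B (n + m.+1))
      (fun x => g1 x * cos (2 * pi * l%:~R * x) - g2 x * sin (2 * pi * l%:~R * x))).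
    exact: cvg_tailS _ (bdcontB (bdcontM b1 cs) (bdcontM b2 sn)).
  by apply/funext => m; rewrite Re_avg; apply: eq_avg => x; rewrite /ev /= !mulrA.
apply: cvg_sqr; rewrite [X in X @ _](_ : _ = fun m => avg (atoms R N B (n + m.+1))
    (fun x => g1 x * sin (2 * pi * l%:~R * x) + g2 x * cos (2 * pi * l%:~R * x))).
  exact: cvg_tailS _ (bdcontD (bdcontM b1 sn) (bdcontM b2 cs)).
by apply/funext => m; rewrite Im_avg; apply: eq_avg => x; rewrite /ev /= !mulrA.
Unshelve. all: by end_near. Qed.
End WeakLimit.

(** * Existence of the infinite convolution *)

Section StepFunctions.
Variable R : realType.

Definition unit_prob : probability (measurableTypeR R) R := uniform_prob (@ltr01 R).
Local Notation U := unit_prob.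

(** Half-open, so that the cells are disjoint and those with [i < Q] cover [[0, 1)]; the complement
    of [[0, 1)] is a null set. *)
Definition cell (Q i : nat) : set R := `[i%:R / Q%:R, i.+1%:R / Q%:R[%classic.

Definition step (Q : nat) (a : nat -> R) (w : R) : R :=
  \sum_(i < Q) a i * \1_(cell Q i) w.

Lemma cellP (Q i : nat) (w : R) : (0 < Q)%N ->
  cell Q i w <-> i%:R <= w * Q%:R < i.+1%:R.
Proof.
move=> Q0; rewrite /cell /= in_itv /=.
by rewrite ler_pdivrMr ?ltr0n// ltr_pdivlMr ?ltr0n.
Qed.

Lemma cell_inj (Q i j : nat) (w : R) : (0 < Q)%N ->
  cell Q i w -> cell Q j w -> i = j.
Proof.
move=> Q0 /(cellP _ _ Q0)/andP[iw wi] /(cellP _ _ Q0)/andP[jw wj].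
have := le_lt_trans iw wj; have := le_lt_trans jw wi; rewrite !ltr_nat; lia.
Qed.

Lemma cell_exists (Q : nat) (w : R) : (0 < Q)%N -> 0 <= w < 1 ->
  exists2 i : nat, (i < Q)%N & cell Q i w.
Proof.
move=> Q0 /andP[w0 w1].
have wQ : 0 <= w * Q%:R by rewrite mulr_ge0.
have /andP[tw wt] := truncn_itv wQ.
exists (Num.trunc (w * Q%:R)); last by apply/(cellP _ _ Q0)/andP.
by rewrite -(ltr_nat R) (le_lt_trans tw)// gtr_pMl// ltr0n.
Qed.

Lemma cell_coarse (Q M i : nat) (w : R) : (0 < Q)%N -> (0 < M)%N ->
  cell (Q * M) i w -> cell Q (i %/ M) w.
Proof.
move=> Q0 M0; have QM0 : (0 < Q * M)%N by rewrite muln_gt0 Q0.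
move=> /(cellP _ _ QM0); rewrite natrM mulrA => /andP[iw wi]; apply/(cellP _ _ Q0).
have M0' : 0 < M%:R :> R by rewrite ltr0n.
rewrite -(ler_pM2r M0') -[X in _ && X](ltr_pM2r M0') -!natrM.
rewrite (le_trans _ iw) ?ler_nat ?leq_trunc_div//=.
by rewrite (lt_le_trans wi)// ler_nat ltn_ceil.
Qed.

Lemma stepE (Q i : nat) (a : nat -> R) (w : R) : (i < Q)%N ->
  cell Q i w -> step Q a w = a i.
Proof.
move=> iQ wi; have Q0 : (0 < Q)%N by apply: leq_ltn_trans iQ.
rewrite /step (bigD1 (Ordinal iQ))//= indicE mem_set// mulr1 big1 ?addr0// => j ji.
rewrite indicE memNset ?mulr0// => wj.
by move: ji; rewrite -val_eqE /= (cell_inj Q0 wj wi) eqxx.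
Qed.

Lemma measurable_step (Q : nat) (a : nat -> R) : measurable_fun setT (step Q a).
Proof.
apply: measurable_sum => i; apply: measurable_funM; first exact: measurable_cst.
by apply: measurable_indic; exact: measurable_itv.
Qed.

Lemma unit_prob_cell (Q i : nat) : (i < Q)%N -> U (cell Q i) = (Q%:R^-1)%:E.
Proof.
move=> iQ; have Q0 : 0 < Q%:R :> R by rewrite ltr0n (leq_ltn_trans _ iQ).
rewrite -[cell Q i]setIT -integral_indic//; last exact: measurable_itv.
rewrite integral_uniform//; last first.
  by apply/measurable_EFinP; apply: measurable_indic; exact: measurable_itv.
rewrite subr0 invr1 mul1e integral_indic//; last exact: measurable_itv.
rewrite (_ : cell Q i `&` _ = cell Q i).
  etransitivity; first exact: lebesgue_measure_itv.
  rewrite /= lte_fin ltr_pM2r ?invr_gt0// ltr_nat leqnn.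
  by rewrite -EFinB -mulrBl -natrB// subSnn mul1r.
apply/setIidl => w; rewrite /cell /= !in_itv /= => /andP[iw wi].
rewrite (le_trans _ iw) ?divr_ge0//= (le_trans (ltW wi))//.
by rewrite ler_pdivrMr// mul1r ler_nat.
Qed.

Lemma unit_prob_cell0C : U (~` cell 1 0) = 0%E.
Proof.
rewrite probability_setC; last exact: measurable_itv.
by rewrite unit_prob_cell// invr1 subee.
Qed.

Lemma unit_prob_ae (P : R -> Prop) : (forall w, 0 <= w < 1 -> P w) ->
  {ae U, forall w, P w}.
Proof.
move=> Pw; exists (~` cell 1 0); split.
- by apply: measurableC; exact: measurable_itv.
- exact: unit_prob_cell0C.
- move=> w /= nP; apply: contra_not nP; rewrite /cell /= in_itv /=.
  by rewrite mul0r divr1; exact: Pw.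
Qed.

Lemma integral_step (Q : nat) (a : nat -> R) : (0 < Q)%N ->
  (\int[U]_w (step Q a w)%:E = (Q%:R^-1 * \sum_(i < Q) a i)%:E)%E.
Proof.
move=> Q0; under eq_integral do rewrite /step -sumEFin.
have mc i : measurable (cell Q i : set (measurableTypeR R)) by exact: measurable_itv.
have ici i : U.-integrable setT (EFin \o \1_(cell Q i)).
  exact: integrable_indic.
rewrite integral_sum//; last by move=> i; exact: (integrableZl measurableT (a i) (ici i)).
rewrite mulr_sumr -sumEFin; apply: eq_bigr => i _.
transitivity (\int[U]_x ((a i)%:E * (\1_(cell Q i) x)%:E))%E.
  by apply: eq_integral => x _; rewrite EFinM.
rewrite integralZl//; last exact: ici.
rewrite integral_indic//; transitivity ((a i)%:E * U (cell Q i))%E.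
  by congr (_ * U _)%E; rewrite setIT.
by rewrite unit_prob_cell// -EFinM mulrC.
Qed.

Lemma integral_eq_step (Q : nat) (a : nat -> R) (F : R -> R) : (0 < Q)%N ->
  measurable_fun setT F ->
  (forall i w, (i < Q)%N -> cell Q i w -> F w = a i) ->
  (\int[U]_w (F w)%:E = (Q%:R^-1 * \sum_(i < Q) a i)%:E)%E.
Proof.
move=> Q0 mF Fa; rewrite -integral_step//; apply: ae_eq_integral => //.
- exact/measurable_EFinP.
- by apply/measurable_EFinP; exact: measurable_step.
- apply: unit_prob_ae => w w01 _; have [i iQ wi] := cell_exists Q0 w01.
  by rewrite (Fa i)// (stepE _ iQ).
Qed.

End StepFunctions.

Lemma sum_modn (V : nmodType) (Q M : nat) (g : nat -> V) :
  \sum_(i < Q * M) g (i %% M)%N = (\sum_(r < M) g r) *+ Q.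
Proof.
elim: Q => [|Q IH]; first by rewrite mul0n big_ord0.
rewrite mulSn big_split_ord /= mulrS -IH; congr (_ + _).
  by apply: eq_bigr => i _; rewrite modn_small.
by apply: eq_bigr => i _; rewrite modnDl.
Qed.

(** Position [i] in a product list encodes a quotient and a remainder, so an index into [atoms] is a
    number in mixed radix whose digits select the [b_j]. *)
Lemma nth_allpairs (S T V : Type) (f : S -> T -> V) (s : seq S) (t : seq T)
    x0 y0 z0 i : (i < size s * size t)%N ->
  nth z0 [seq f x y | x <- s, y <- t] i =
  f (nth x0 s (i %/ size t)) (nth y0 t (i %% size t)).
Proof.
elim: s i => [|x s IH] i; first by rewrite mul0n.
rewrite /= mulSn nth_cat size_map => iQ; case: ltnP => it.
  by rewrite (nth_map y0)// divn_small// modn_small.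
have t0 : (0 < size t)%N by case: (size t) iQ it => //; rewrite muln0 addn0.
rewrite -{2 3}(subnK it) divnDr// divnn t0 modnDr addn1 /=.
by rewrite -IH// ltn_subLR.
Qed.

(** * Almost sure convergence of the random digit series *)

Section Existence.
Variables (R : realType) (N : nat -> int) (B : nat -> seq int).
Local Notation P := (prodN R N).
Local Notation A := (atoms R N B).
Local Notation Q n := (size (atoms R N B n)).
Local Notation U := (unit_prob R).

Hypothesis N_gt0 : forall n, 0 < N n.
Hypothesis size_B : forall n, (0 < size (B n))%N.
Hypothesis cvg_bad : exists l : R, series (bad_ratio R N B) @ \oo --> l.

Let Q0 n : (0 < Q n)%N. Proof. exact: size_atoms_gt0. Qed.
Let QS n : Q n.+1 = (Q n * size (B n))%N. Proof. exact: size_allpairs. Qed.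

(* The mixed radix digits of a uniform [w] are independent and uniform, so
   [partial n] has the law of the [n]-th finite convolution. *)
Definition partial (n : nat) : R -> R := step (Q n) (nth 0 (A n)).

Definition digit_bad (n i : nat) : bool :=
  ~~ (0 <= nth 0 (B n) (i %% size (B n)) < N n).

Definition bad_event (n : nat) : set (measurableTypeR R) :=
  [set w | step (Q n.+1) (fun i => (digit_bad n i)%:R) w != 0].

(** Refining a cell of level [n] into [size (B n)] equal parts appends one digit, read off as the
    remainder of the cell index. *)
Lemma partialS n i w : (i < Q n.+1)%N -> cell (Q n.+1) i w ->
  partial n.+1 w = partial n w + (nth 0 (B n) (i %% size (B n)))%:~R / P n.+1.
Proof.
move=> iQ wi; rewrite /partial (stepE _ iQ wi).
have iQn : (i %/ size (B n) < Q n)%N by rewrite ltn_divLR// -QS.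
rewrite (stepE _ iQn); last by apply: cell_coarse; rewrite -?QS.
by rewrite QS in iQ; rewrite (nth_allpairs _ 0 0).
Qed.

Lemma measurable_bad_event n : measurable (bad_event n).
Proof.
have := @measurable_step R (Q n.+1) (fun i => (digit_bad n i)%:R).
move=> /(_ measurableT (~` [set 0])); rewrite setTI.
rewrite (_ : bad_event n = step (Q n.+1) (fun i => (digit_bad n i)%:R) @^-1` (~` [set 0])).
  by apply; apply: measurableC; exact: measurable_set1.
by apply/seteqP; split => w /= /eqP.
Qed.

(** Among the [Q n.+1] cells each remainder modulo [size (B n)] occurs equally often, so the new
    digit is uniform on [B n]. *)
Lemma prob_bad_event n : U (bad_event n) = (bad_ratio R N B n)%:E.
Proof.
have mb := measurable_bad_event n.
rewrite -[bad_event n]setIT -integral_indic//.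
rewrite (@integral_eq_step _ (Q n.+1) (fun i => (digit_bad n i)%:R))//.
- congr EFin; rewrite QS.
  rewrite (sum_modn _ _ (fun r => (~~ (0 <= nth 0 (B n) r < N n))%:R)).
  rewrite -[X in _ * X = _]mulr_natl natrM invfM mulrACA mulVf ?mul1r ?pnatr_eq0 -?lt0n//.
  by rewrite bad_ratioE /avg (big_nth 0) big_mkord.
- move=> i w iQ wi; rewrite indicE.
  have : (w \in bad_event n) = digit_bad n i.
    apply/idP/idP; rewrite inE /bad_event /= (stepE _ iQ wi).
      by case: digit_bad => //; rewrite eqxx.
    by move=> ->; rewrite oner_eq0.
  by move=> ->.
Qed.

Lemma integral_partial n (f : R -> R) : measurable_fun setT f ->
  (\int[U]_w (f (partial n w))%:E = (avg (A n) f)%:E)%E.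
Proof.
move=> mf; rewrite (@integral_eq_step _ (Q n) (fun i => f (nth 0 (A n) i)))//.
- by rewrite /avg (big_nth 0) big_mkord.
- by apply: measurableT_comp => //; exact: measurable_step.
- by move=> i w iQ wi; rewrite /partial (stepE _ iQ wi).
Qed.

(** Borel-Cantelli, the probabilities being the summable bad ratios. *)
Lemma prob_limsup_bad : U (lim_sup_set bad_event) = 0%E.
Proof.
apply: lim_sup_set_cvg0; first exact: measurable_bad_event.
have [l sl] := cvg_bad.
rewrite [ltLHS](_ : _ = l%:E) ?ltry//; apply/cvg_lim => //.
rewrite [X in X @ _](_ : _ = EFin \o series (bad_ratio R N B)).
  by apply: cvg_EFin => //; exact: nearW.
apply/funext => n; rewrite /= -sumEFin; apply: eq_bigr => i _.
exact: prob_bad_event.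
Qed.

Let Pgt0 n : 0 < P n. Proof. exact: prodN_gt0. Qed.

(** A good digit satisfies [b <= N n - 1], and [(N n - 1) / P n.+1] is exactly
    [1 / P n - 1 / P n.+1], so successive increments telescope. *)
Lemma partial_increment n w : 0 <= w < 1 -> ~ bad_event n w ->
  partial n w <= partial n.+1 w <= partial n w + ((P n)^-1 - (P n.+1)^-1).
Proof.
move=> w01; have [i iQ wi] := cell_exists (Q0 n.+1) w01.
rewrite /bad_event /= (stepE _ iQ wi) (partialS iQ wi) /digit_bad.
set b := nth 0 _ _; case: (boolP (0 <= b < N n)) => [/andP[b0 bN] _|_]; last first.
  by case; exact: oner_neq0.
have b0' : 0 <= b%:~R :> R by rewrite ler0z.
have bN' : b%:~R + 1 <= (N n)%:~R :> R.
  by rewrite -[1 in leLHS]/(1%:~R) -intrD ler_int; lia.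
have P1 := Pgt0 n.+1; have P2 := Pgt0 n.
have -> : (P n)^-1 = (N n)%:~R / P n.+1.
  have n0 : (N n)%:~R != 0 :> R by rewrite intr_eq0 gt_eqF.
  by rewrite prodNS; field; rewrite n0 gt_eqF.
rewrite lerDl divr_ge0 ?(ltW P1)//= lerD2l -[X in _ - X]mul1r -mulrBl.
by rewrite ler_pM2r ?invr_gt0//; lra.
Qed.

(** After the last bad event the partial sums are nondecreasing, and the telescoping bound keeps
    them below [partial n0 w + 1 / P n0]. *)
Lemma cvg_partial w : 0 <= w < 1 -> ~ lim_sup_set bad_event w ->
  cvg (partial^~ w @ \oo).
Proof.
move=> w01; rewrite /lim_sup_set => /existsNP[n0 /not_implyP[_ nb]].
have {}nb j : (n0 <= j)%N -> ~ bad_event j w by move=> nj bj; apply: nb; exists j.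
suff /cvg_ex[l] : cvg ((fun k => partial (k + n0) w) @ \oo).
  by rewrite (cvg_shiftn n0 (partial^~ w)) => ?; apply/cvg_ex; exists l.
apply: nondecreasing_is_cvgn.
  apply/nondecreasing_seqP => k; rewrite addSn.
  by have /andP[] := partial_increment w01 (nb (k + n0)%N (leq_addl _ _)).
exists (partial n0 w + (P n0)^-1) => _ [k _ <-] /=.
suff : partial (k + n0) w <= partial n0 w + ((P n0)^-1 - (P (k + n0))^-1).
  by move=> /le_trans; apply; rewrite lerD2l gerBl invr_ge0 ltW.
elim: k => [|k IH]; first by rewrite add0n subrr addr0.
have /andP[_] := partial_increment w01 (nb (k + n0)%N (leq_addl _ _)).
by rewrite addSn; lra.
Qed.

Definition good_set : set (measurableTypeR R) :=
  cell 1 0 `\` lim_sup_set bad_event.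

Let cell10 (w : R) : cell 1 0 w <-> 0 <= w < 1.
Proof. by rewrite cellP// mulr1. Qed.

Let measurable_good : measurable good_set.
Proof.
apply: measurableD; first exact: measurable_itv.
apply: bigcap_measurable => // k _; apply: bigcup_measurable => j _.
exact: measurable_bad_event.
Qed.

(** The indicator makes the sequence converge at every point, so that measurability of the limit
    follows directly. *)
Definition limit_rv (w : R) : R :=
  lim ((fun n => partial n w * \1_good_set w) @ \oo).

Let cvg_limit_rv w :
  (fun n => partial n w * \1_good_set w) @ \oo --> limit_rv w.
Proof.
suff : cvg ((fun n => partial n w * \1_good_set w) @ \oo) by [].
have [[/cell10 w01 wb]|wG] := pselect (good_set w).
  by apply: is_cvgMl; exact: cvg_partial.
by rewrite indicE memNset//; under eq_fun do rewrite mulr0; exact: is_cvg_cst.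
Qed.

Lemma measurable_limit_rv : measurable_fun setT limit_rv.
Proof.
apply: (@measurable_fun_cvg _ _ _ _ (fun n w => partial n w * \1_good_set w)) => [n|w _].
  apply: measurable_funM; first exact: measurable_step.
  exact: measurable_indic.
exact: cvg_limit_rv.
Qed.

Lemma ae_cvg_partial : {ae U, forall w, partial^~ w @ \oo --> limit_rv w}.
Proof.
have good1 : U (~` good_set) = 0%E.
  rewrite /good_set setDE setCI setCK; apply: null_set_setU => //.
  - by apply: measurableC; exact: measurable_itv.
  - apply: bigcap_measurable => // k _; apply: bigcup_measurable => j _.
    exact: measurable_bad_event.
  - exact: unit_prob_cell0C.
  - exact: prob_limsup_bad.
exists (~` good_set); split => //; first exact: measurableC.
move=> w /=; apply: contra_not => wG; have := @cvg_limit_rv w.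
by rewrite indicE mem_set//; under eq_fun do rewrite mulr1.
Qed.

(** The measure is the law of [limit_rv]. Almost sure convergence and continuity of [f] pass to the
    integrals by dominated convergence, the bound of [f] serving as constant majorant. *)
Lemma limit_measure_exists : exists mu : probability R R,
  forall f : R -> R, bdcont f ->
  (fun n => (avg (A n) f)%:E) @ \oo --> (\int[mu]_x (f x)%:E)%E.
Proof.
have mX : (limit_rv : measurableTypeR R -> R) \in mfun.
  by rewrite inE /=; exact: measurable_limit_rv.
pose X : {mfun measurableTypeR R >-> R} := mfun_Sub mX.
exists (distribution U X) => f bf.
have mf := bdcont_measurable bf; have [cf [M fM]] := bf.
have mfX : measurable_fun setT (f \o limit_rv : measurableTypeR R -> R).
  by apply: measurableT_comp => //; exact: measurable_limit_rv.
have fXi : U.-integrable setT (EFin \o (f \o limit_rv)).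
  apply: measurable_bounded_integrable => //.
    by apply: le_lt_trans (probability_le1 U measurableT) _; exact: ltry.
  by exists M; split; [exact: num_real|move=> K MK x _ /=; rewrite (le_trans (fM _))// ltW].
rewrite integral_distribution//; last exact/measurable_EFinP.
under eq_fun do rewrite -integral_partial//.
have [] := @dominated_convergence _ _ _ U setT measurableT
  (fun n w => (f (partial n w))%:E) (fun w => (f (limit_rv w))%:E) (fun=> M%:E).
- move=> n; apply/measurable_EFinP; apply: measurableT_comp => //.
  exact: measurable_step.
- exact/measurable_EFinP.
- have [Z [mZ Z0 sZ]] := ae_cvg_partial; exists Z; split => // w /= nw.
  apply: sZ => /= pw; apply: nw => _.
  by apply: cvg_EFin; [exact: nearW|exact: cvg_comp pw (cf _)].
- exact: finite_measure_integrable_cst.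
- by apply: aeW => w n _; rewrite lee_fin.
by move=> _ _.
Qed.

End Existence.

(** * Density of bounded Lipschitz functions *)

Section LipschitzDense.
Import HBNNSimple.
Variable R : realType.

Lemma bdlip_cst c : bdlip (fun=> c : R).
Proof. by exists 0, `|c|; split => // x y; rewrite subrr normr0 mul0r. Qed.

Lemma bdlipD f g : bdlip f -> bdlip g -> bdlip (fun x : R => f x + g x).
Proof.
move=> [M [K [fM fK]]] [M' [K' [gM gK]]]; exists (M + M'), (K + K'); split.
  move=> x y; rewrite opprD addrACA mulrDl.
  by rewrite (le_trans (ler_normD _ _))// lerD.
by move=> x; rewrite (le_trans (ler_normD _ _))// lerD.
Qed.

Lemma bdlipZ c f : bdlip f -> bdlip (fun x : R => c * f x).
Proof.
move=> [M [K [fM fK]]]; exists (`|c| * M), (`|c| * K); split.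
  by move=> x y; rewrite -mulrBr normrM -mulrA ler_wpM2l.
by move=> x; rewrite normrM ler_wpM2l.
Qed.

Definition clamp (t : R) : R :=
  if t <= 0 then 0 else if 1 <= t then 1 else t.

Lemma clamp01 t : 0 <= clamp t <= 1.
Proof.
rewrite /clamp.
by case: (lerP t 0) => ?; case: (lerP 1 t) => ?; apply/andP; split; lra.
Qed.

Lemma clamp_lipschitz s t : `|clamp s - clamp t| <= `|s - t|.
Proof.
rewrite /clamp ler_norml.
by case: (lerP s 0) => ?; case: (lerP t 0) => ?; case: (lerP 1 s) => ?;
  case: (lerP 1 t) => ?; case: (ler0P (s - t)) => ?; apply/andP; split; lra.
Qed.

Lemma bdlip_clamp k c : bdlip (fun x : R => clamp (k * (c - x))).
Proof.
exists `|k|, 1; split=> [x y|x].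
  rewrite (le_trans (clamp_lipschitz _ _))// -mulrBr normrM ler_wpM2l//.
  by rewrite opprB addrC addrA subrK -normrN opprB.
by have /andP[c0 c1] := clamp01 (k * (c - x)); rewrite ger0_norm.
Qed.

Variable mu : probability R R.
Local Notation "'SI' f" := (\int[mu]_x ((f x) ^+ 2)%:E)%E
  (at level 10, f at level 9).

Lemma ge0_SI (f : R -> R) : (0 <= SI f)%E.
Proof. by apply: integral_ge0 => x _; rewrite lee_fin sqr_ge0. Qed.

Lemma measurable_sqr (f : R -> R) : measurable_fun setT f ->
  measurable_fun setT (fun x => ((f x) ^+ 2)%:E).
Proof. by move=> mf; apply/measurable_EFinP; exact: measurable_funX. Qed.

(** Pointwise [(f + g)^2 <= 2 f^2 + 2 g^2], in place of Minkowski's inequality: the factor 2 is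
    harmless for approximation. *)
Lemma SI_triangle (f g h : R -> R) : measurable_fun setT f ->
  measurable_fun setT g -> (forall x, h x = f x + g x) ->
  (SI h <= 2%:E * SI f + 2%:E * SI g)%E.
Proof.
move=> mf mg hE.
have mf2 := measurable_sqr mf; have mg2 := measurable_sqr mg.
rewrite -!ge0_integralZl//; try by move=> x _; rewrite lee_fin sqr_ge0.
rewrite -ge0_integralD//; first last.
- exact: measurable_funeM.
- by move=> x _; rewrite -EFinM lee_fin mulr_ge0 ?sqr_ge0.
- exact: measurable_funeM.
- by move=> x _; rewrite -EFinM lee_fin mulr_ge0 ?sqr_ge0.
apply: ge0_le_integral => //.
- by move=> x _; rewrite lee_fin sqr_ge0.
- apply: measurable_sqr; rewrite (_ : h = fun x => f x + g x).
    exact: measurable_funD.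
  exact/funext.
- by apply: emeasurable_funD; exact: measurable_funeM.
- move=> x _; rewrite -!EFinM -EFinD lee_fin hE.
  by have := sqr_ge0 (f x - g x); nra.
Qed.

(** Membership in the closure of the bounded Lipschitz functions in [L^2(mu)], with [e] bounding the
    squared distance. *)
Definition approx_bdlip (u : R -> R) : Prop := measurable_fun setT u /\
  forall e : R, 0 < e -> exists2 g, bdlip g & (SI (u \- g) <= e%:E)%E.

Lemma bdlip_measurable (g : R -> R) : bdlip g -> measurable_fun setT g.
Proof. by move=> /bdlip_bdcont; exact: bdcont_measurable. Qed.

Lemma approx_bdlip_id (g : R -> R) : bdlip g -> approx_bdlip g.
Proof.
move=> lg; split; first exact: bdlip_measurable.
move=> e e0; exists g => //; rewrite integral0_eq ?lee_fin ?ltW// => x _.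
by rewrite /= subrr expr0n.
Qed.

Lemma approx_bdlipD u v : approx_bdlip u -> approx_bdlip v ->
  approx_bdlip (fun x => u x + v x).
Proof.
move=> [mu' au] [mv av]; split; first exact: measurable_funD.
move=> e e0; have e4 : 0 < e / 4 by rewrite divr_gt0.
have [g lg ug] := au _ e4; have [h lh vh] := av _ e4.
exists (fun x => g x + h x); first exact: bdlipD.
apply: le_trans (SI_triangle (f := u \- g) (g := v \- h) _ _ _) _.
- by apply: measurable_funB => //; exact: bdlip_measurable.
- by apply: measurable_funB => //; exact: bdlip_measurable.
- by move=> x /=; ring.
apply: (@le_trans _ _ (2%:E * (e / 4)%:E + 2%:E * (e / 4)%:E)%E).
  by apply: leeD; apply: lee_pmul => //; exact: ge0_SI.
by rewrite -!EFinM -EFinD lee_fin; lra.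
Qed.

Lemma approx_bdlipZ c u : approx_bdlip u -> approx_bdlip (fun x => c * u x).
Proof.
move=> [mu' au]; split; first by apply: measurable_funM => //; exact: measurable_cst.
move=> e e0; have c0 : 0 < c ^+ 2 + 1 by rewrite ltr_wpDl ?sqr_ge0.
have [g lg ug] := au (e / (c ^+ 2 + 1)) (divr_gt0 e0 c0).
exists (fun x => c * g x); first exact: bdlipZ.
have -> : SI ((fun x => c * u x) \- (fun x => c * g x)) =
    ((c ^+ 2)%:E * SI (u \- g))%E.
  rewrite -ge0_integralZl//.
  - by apply: eq_integral => x _; rewrite -EFinM /= -mulrBr exprMn.
  - by apply: measurable_sqr; apply: measurable_funB => //; exact: bdlip_measurable.
  - by move=> x _; rewrite lee_fin sqr_ge0.
  - by rewrite lee_fin sqr_ge0.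
apply: (@le_trans _ _ ((c ^+ 2 + 1)%:E * (e / (c ^+ 2 + 1))%:E)%E).
  by apply: lee_pmul => //; rewrite ?lee_fin ?sqr_ge0 ?ge0_SI// lerDl.
by rewrite -EFinM lee_fin mulrC divfK// gt_eqF.
Qed.

Lemma approx_bdlipB u v : approx_bdlip u -> approx_bdlip v ->
  approx_bdlip (fun x => u x - v x).
Proof.
move=> au /(approx_bdlipZ (-1)) av; have := approx_bdlipD au av.
by under [X in approx_bdlip X -> _]eq_fun do rewrite mulN1r.
Qed.

Lemma approx_bdlip_sum n (F : nat -> R -> R) : (forall i, approx_bdlip (F i)) ->
  approx_bdlip (fun x => \sum_(i < n) F i x).
Proof.
move=> aF; elim: n => [|n IH].
  by under eq_fun do rewrite big_ord0; apply/approx_bdlip_id/bdlip_cst.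
by under eq_fun do rewrite big_ord_recr; exact: approx_bdlipD.
Qed.

(** Dominated convergence gives [v n -> u] in [L^2(mu)]; an approximation of a late [v n] then
    approximates [u]. *)
Lemma approx_bdlip_cvg (v : nat -> R -> R) (u h : R -> R) :
  (forall n, approx_bdlip (v n)) ->
  (forall x, v^~ x @ \oo --> u x) ->
  mu.-integrable setT (EFin \o h) ->
  (forall n x, (u x - v n x) ^+ 2 <= h x) ->
  approx_bdlip u.
Proof.
move=> av vu hi uvh.
have mv n : measurable_fun setT (v n) by case: (av n).
have mu' : measurable_fun setT u by apply: (measurable_fun_cvg mv) => x _; exact: vu.
split => // e e0; have e4 : 0 < e / 4 by rewrite divr_gt0.
have [] := @dominated_convergence _ _ _ mu setT measurableT
  (fun n x => ((u x - v n x) ^+ 2)%:E) (fun=> 0%E) (EFin \o h).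
- by move=> n; apply: measurable_sqr; exact: measurable_funB.
- exact: measurable_cst.
- apply: aeW => x _; apply: cvg_EFin; first exact: nearW.
  have uv : (fun n => u x - v n x) @ \oo --> (0 : R).
    by rewrite -(subrr (u x)); apply: cvgB; [exact: cvg_cst|exact: vu].
  by rewrite -[X in _ --> X](mulr0 (0 : R)); exact: (cvgM uv uv).
- exact: hi.
- by apply: aeW => x n _; rewrite /= lee_fin ger0_norm ?sqr_ge0.
move=> _ _; rewrite integral0 => cvg0.
have [n vn] : exists n, (SI (u \- v n) <= (e / 4)%:E)%E.
  move/fine_cvgP: cvg0 => [fin0 cvg0].
  have [n _ vn] : \forall n \near \oo, (SI (u \- v n) <= (e / 4)%:E)%E.
    near=> n; rewrite -[leLHS]fineK; first rewrite lee_fin.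
      by near: n; exact: (cvgr_le 0 cvg0).
    by near: n.
  by exists n; exact: (vn n (leqnn n)).
have [g lg vg] := (av n).2 _ e4; exists g => //.
apply: le_trans (SI_triangle (f := u \- v n) (g := v n \- g) _ _ _) _.
- exact: measurable_funB.
- by apply: measurable_funB => //; exact: bdlip_measurable.
- by move=> x /=; ring.
apply: (@le_trans _ _ (2%:E * (e / 4)%:E + 2%:E * (e / 4)%:E)%E).
  by apply: leeD; apply: lee_pmul => //; exact: ge0_SI.
by rewrite -!EFinM -EFinD lee_fin; lra.
Unshelve. all: by end_near. Qed.

Let cst_integrable (c : R) : mu.-integrable setT (EFin \o fun=> c).
Proof. exact: finite_measure_integrable_cst. Qed.

(** Ramps of steepness [n], vanishing from [c] on, converge to the indicator; the constant 1
    dominates the squared errors. *)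
Lemma approx_bdlip_ray c : approx_bdlip \1_(`]-oo, c[%classic).
Proof.
apply: (approx_bdlip_cvg (v := fun n x => clamp (n%:R * (c - x))) (h := fun=> 1)) => //.
- by move=> n; apply/approx_bdlip_id/bdlip_clamp.
- move=> x; rewrite indicE; case: (ltP x c) => xc.
    rewrite mem_set /= ?in_itv//=; apply: cvg_near_cst.
    near=> n; rewrite /clamp; have cx : 0 < c - x by rewrite subr_gt0.
    have : (c - x)^-1 <= n%:R by near: n; exact: nbhs_infty_ger.
    rewrite -[_^-1]mul1r ler_pdivrMr// => n1.
    by rewrite leNgt (lt_le_trans ltr01 n1) /= n1.
  rewrite memNset; last by rewrite /= in_itv/= ltNge xc.
  apply: cvg_near_cst; near=> n; rewrite /clamp.
  by rewrite mulr_ge0_le0// subr_le0.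
- move=> n x; have /andP[] := clamp01 (n%:R * (c - x)); rewrite indicE.
  by case: (_ \in _) => /= ? ?; nra.
Unshelve. all: by end_near. Qed.

(** Dynkin's pi-lambda theorem: open rays are stable under intersection and generate the Borel sets,
    while the approximable sets are stable under proper differences and increasing unions. *)
Lemma approx_bdlip_indic (A : set R) : measurable A -> approx_bdlip \1_A.
Proof.
pose H := [set A : set R | measurable A /\ approx_bdlip \1_A].
suff : (@measurable _ R : set (set R)) `<=` H by move=> /[apply] -[].
rewrite [X in X `<=` _](RGenInftyO.measurableE R); apply: lambda_system_subset.
- move=> _ _ [x ->] [y ->]; exists (Num.min x y).
  by apply/seteqP; split => z /=; rewrite !in_itv/= lt_min => /andP.
- split => //.
  + split; first exact: measurableT.
    by rewrite (_ : \1_setT = fun=> 1) ?indicT//; apply/approx_bdlip_id/bdlip_cst.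
  + move=> A' B' BA [mA aA] [mB aB]; split; first exact: measurableD.
    rewrite (_ : \1_(A' `\` B') = fun x => \1_A' x - \1_B' x); first exact: approx_bdlipB.
    apply/funext => x; rewrite !indicE in_setD.
    have : x \in B' -> x \in A' by rewrite !in_setE; exact: BA.
    case: (x \in B') => [->//|_]; first by rewrite andbF subrr.
    by rewrite andbT subr0.
  + move=> F ndF HF; have mF n : measurable (F n) by case: (HF n).
    split; first exact: bigcupT_measurable.
    apply: (approx_bdlip_cvg (v := fun n => \1_(F n)) (h := fun=> 1)) => //.
    * by move=> n; case: (HF n).
    * move=> x; rewrite indicE; have [[n _ Fnx]|nF] := pselect ((\bigcup_k F k) x).
        rewrite mem_set; last by exists n.
        apply: cvg_near_cst; exists n => // m /= nm; rewrite indicE mem_set//.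
        by have /subsetPset := ndF _ _ nm; apply.
      rewrite memNset//; apply: cvg_near_cst; apply: nearW => n.
      by rewrite indicE memNset// => Fnx; apply: nF; exists n.
- move=> _ [x ->]; split; first exact: measurable_itv.
  exact: approx_bdlip_ray.
- by [].
Qed.

(** Simple functions increasing to [u] are linear combinations of indicators, and
    [(u - s n) ^ 2 <= u ^ 2] supplies the majorant. *)
Lemma approx_bdlip_ge0 (u : R -> R) : measurable_fun setT u ->
  (forall x, 0 <= u x) -> mu.-integrable setT (fun x => ((u x) ^+ 2)%:E) ->
  approx_bdlip u.
Proof.
move=> mu' u0 ui.
have [s [nds su]] := approximation (measurableT : measurable setT)
  (proj2 (measurable_EFinP setT u) mu') (fun x _ => (u0 x : (0 <= (u x)%:E)%E)).
have cvg_s x : (fun n => s n x) @ \oo --> u x.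
  by have := su x I; move/fine_cvgP => [].
have s_le n x : s n x <= u x.
  rewrite -(cvg_lim _ (cvg_s x))//; apply: nondecreasing_cvgn_le.
    by move=> k m km; exact: (lefP _ _ (nds _ _ km)).
  by apply/cvg_ex; exists (u x); exact: cvg_s.
apply: (approx_bdlip_cvg (v := fun n => s n) (h := fun x => u x ^+ 2)) => //.
- move=> n; have -> : (s n : R -> R) = (fun x => s n x) by [].
  under eq_fun do rewrite fimfunEord.
  apply: (@approx_bdlip_sum _ (fun i x => nth 0 _ i *
    \1_(s n @^-1` [set nth 0 _ i]) x)) => i.
  by apply/approx_bdlipZ/approx_bdlip_indic.
- move=> n x; have := s_le n x; have : 0 <= s n x by [].
  by have := u0 x; nra.
Qed.

Lemma bdlip_dense (u : R -> R) : measurable_fun setT u ->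
  mu.-integrable setT (fun x => ((u x) ^+ 2)%:E) -> approx_bdlip u.
Proof.
move=> mu' ui.
have part (p : R -> R) : measurable_fun setT p ->
    (forall x, 0 <= p x) -> (forall x, p x ^+ 2 <= u x ^+ 2) -> approx_bdlip p.
  move=> mp p0 pu; apply: approx_bdlip_ge0 => //.
  apply: le_integrable ui => //; first exact: measurable_sqr.
  by move=> x _; rewrite /= lee_fin !ger0_norm ?sqr_ge0.
have mabs : measurable_fun setT (fun x => `|u x|) by exact: measurableT_comp.
rewrite (_ : u = fun x => (`|u x| + u x) / 2 - (`|u x| - u x) / 2); last first.
  by apply/funext => x; field.
apply: approx_bdlipB; apply: part.
- by apply: measurable_funM => //; apply: measurable_funD.
- by move=> x; have := ler_norm (- u x); rewrite normrN => ?; apply: divr_ge0; lra.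
- by move=> x; case: (ler0P (u x)) => ?; nra.
- by apply: measurable_funM => //; apply: measurable_funB.
- by move=> x; rewrite divr_ge0// subr_ge0 ler_norm.
- by move=> x; case: (ler0P (u x)) => ?; nra.
Qed.

End LipschitzDense.

(** * Spectrality *)

Section Spectrality.
Variables (R : realType) (N : nat -> int) (B L : nat -> seq int).
Variable mu : probability R R.
Local Notation "'I' f" := (Rintegral mu setT f) (at level 10, f at level 9).
Local Notation integr f := (mu.-integrable setT (EFin \o (f : R -> R))).

Hypothesis N_ge2 : forall n, 2 <= N n.
Hypothesis size_B : forall n, (2 <= size (B n))%N.
Hypothesis L0 : forall n, 0 \in L n.
Hypothesis parsL : forall n, parseval R (N n) (B n) (L n).
Hypothesis cvg_bad : exists l : R, series (bad_ratio R N B) @ \oo --> l.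
Hypothesis muW : weak_limit N B mu.
Hypothesis gc_often : forall n, exists2 k, (n <= k)%N & general_consecutive (N k) (B k).

Let N_gt0 n : 0 < N n. Proof. exact: lt_le_trans (N_ge2 n). Qed.
Let B0 n : (0 < size (B n))%N. Proof. exact: leq_trans (size_B n). Qed.

Let cs (l : int) (x : R) := cos (2 * pi * l%:~R * x).
Let sn (l : int) (x : R) := sin (2 * pi * l%:~R * x).

Let bcs l : bdcont (cs l). Proof. exact: bdcont_cos. Qed.
Let bsn l : bdcont (sn l). Proof. exact: bdcont_sin. Qed.

Lemma integralE (f : R -> R) : integr f ->
  (\int[mu]_x (f x)%:E)%E = (I f)%:E.
Proof. by move=> fi; rewrite fineK//; exact: integrable_fin_num. Qed.

Let integrD f g : integr f -> integr g -> integr (fun x => f x + g x).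
Proof. by move=> fi gi; exact: (integrableD measurableT fi gi). Qed.

Let integrZ c f : integr f -> integr (fun x => c * f x).
Proof. by move=> fi; exact: (integrableZl measurableT c fi). Qed.

Let integrB f g : integr f -> integr g -> integr (fun x => f x - g x).
Proof. by move=> fi gi; exact: (integrableB measurableT fi gi). Qed.

Lemma Rintegral_sum (T : Type) (s : seq T) (F : T -> R -> R) :
  (forall t, integr (F t)) ->
  integr (fun x => \sum_(t <- s) F t x) /\
  I (fun x => \sum_(t <- s) F t x) = \sum_(t <- s) I (F t).
Proof.
move=> Fi; elim: s => [|t s [si IH]].
  have -> : (fun x => \sum_(t <- [::]) F t x) = fun=> 0.
    by apply/funext => x; rewrite big_nil.
  split; first exact: (bdcont_integrable mu (bdcont_cst _)).
  by rewrite big_nil Rintegral_cst// mul0r.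
have -> : (fun x => \sum_(j <- t :: s) F j x) =
    fun x => F t x + \sum_(j <- s) F j x.
  by apply/funext => x; rewrite big_cons.
by split; [exact: integrD|rewrite RintegralD// IH big_cons].
Qed.

(** The lists are increasing, so orthogonality holds at every level [n + m]; the approximating
    averages are constant and the weak limit inherits their value. *)
Lemma Rintegral_spec n (k l : int) : k \in spec N L n -> l \in spec N L n ->
  I (fun x => cos (2 * pi * (k%:~R - l%:~R) * x)) = (k == l)%:R /\
  I (fun x => sin (2 * pi * (k%:~R - l%:~R) * x)) = 0.
Proof.
move=> kn ln.
have orth m := spec_orth N_gt0 parsL B0 (spec_sub N_gt0 L0 m kn) (spec_sub N_gt0 L0 m ln).
have cC := cvg_avg_tail muW n (bdcont_cos (k%:~R - l%:~R : R)).
have cS := cvg_avg_tail muW n (bdcont_sin (k%:~R - l%:~R : R)).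
split.
- apply: (cvg_unique _ cC) => //; apply: cvg_near_cst; apply: nearW => m.
  transitivity (complex.Re (avg (atoms R N B (n + m))
      (fun x => ev ((k%:~R - l%:~R) * x)))).
    by rewrite Re_avg; apply: eq_avg => x; rewrite /ev /= !mulrA.
  by rewrite orth; case: (k == l).
- apply: (cvg_unique _ cS) => //; apply: cvg_near_cst; apply: nearW => m.
  transitivity (complex.Im (avg (atoms R N B (n + m))
      (fun x => ev ((k%:~R - l%:~R) * x)))).
    by rewrite Im_avg; apply: eq_avg => x; rewrite /ev /= !mulrA.
  by rewrite orth; case: (k == l).
Qed.

Section Expansion.
Variables (s : seq int) (al be : int -> R).

(* Real and imaginary parts of the sum of [(al l + i be l) e^{-2 pi i l x}]. *)
Let p1 x := \sum_(l <- s) (al l * cs l x + be l * sn l x).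
Let p2 x := \sum_(l <- s) (be l * cs l x - al l * sn l x).

Let bp1 : bdcont p1.
Proof. by apply: bdcont_sum => l; apply: bdcontD; apply: bdcontM => //; exact: bdcont_cst. Qed.

Let bp2 : bdcont p2.
Proof. by apply: bdcont_sum => l; apply: bdcontB; apply: bdcontM => //; exact: bdcont_cst. Qed.

(** This is the real part of [<h, p>] for [h = h1 + i h2] and [p = p1 + i p2], expanded along the
    frequencies in [s]. *)
Lemma Rintegral_pairing (h1 h2 : R -> R) : integr h1 -> integr h2 ->
  integr (fun x => h1 x * p1 x + h2 x * p2 x) /\
  I (fun x => h1 x * p1 x + h2 x * p2 x) =
  \sum_(l <- s) (al l * I (fun x => h1 x * cs l x - h2 x * sn l x) +
                 be l * I (fun x => h1 x * sn l x + h2 x * cs l x)).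
Proof.
move=> i1 i2.
have iA l : integr (fun x => h1 x * cs l x - h2 x * sn l x).
  by apply: integrB; exact: integrable_bdcontM.
have iB l : integr (fun x => h1 x * sn l x + h2 x * cs l x).
  by apply: integrD; exact: integrable_bdcontM.
pose F l x := al l * (h1 x * cs l x - h2 x * sn l x) +
              be l * (h1 x * sn l x + h2 x * cs l x).
have -> : (fun x => h1 x * p1 x + h2 x * p2 x) = (fun x => \sum_(l <- s) F l x).
  apply/funext => x; rewrite /p1 /p2 !mulr_sumr -big_split; apply: eq_bigr => l _.
  by rewrite /F /=; ring.
have iF l : integr (F l) by apply: integrD; exact: integrZ.
have [iS ->] := Rintegral_sum s iF; split => //.
apply: eq_bigr => l _; rewrite /F RintegralD//; [|exact: integrZ|exact: integrZ].
by rewrite !RintegralZl.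
Qed.

(** Pairing [p] with itself reduces the norm to the coefficients of [p], and orthonormality
    identifies those with [al] and [be]. *)
Lemma Rintegral_expansion_norm n : s = spec N L n ->
  I (fun x => p1 x * p1 x + p2 x * p2 x) = \sum_(l <- s) (al l ^+ 2 + be l ^+ 2).
Proof.
move=> sE; have us : uniq s by rewrite sE; exact: spec_uniq.
have [_ ->] := Rintegral_pairing (bdcont_integrable mu bp1) (bdcont_integrable mu bp2).
rewrite !big_seq; apply: eq_bigr => l ls.
have iC k : integr (fun x => cos (2 * pi * (k%:~R - l%:~R) * x)).
  exact/bdcont_integrable/bdcont_cos.
have iS k : integr (fun x => sin (2 * pi * (k%:~R - l%:~R) * x)).
  exact/bdcont_integrable/bdcont_sin.
have csB (k : int) x : cos (2 * pi * (k%:~R - l%:~R) * x) = cs k x * cs l x + sn k x * sn l x.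
  by rewrite mulrBr mulrBl cosB.
have snB (k : int) x : sin (2 * pi * (k%:~R - l%:~R) * x) = sn k x * cs l x - cs k x * sn l x.
  by rewrite mulrBr mulrBl sinB.
have dual (a b : int -> R) : \sum_(k <- s) (a k * I (fun x => cos (2 * pi * (k%:~R - l%:~R) * x))
    + b k * I (fun x => sin (2 * pi * (k%:~R - l%:~R) * x))) = a l.
  rewrite (bigD1_seq l)//= big_seq_cond big1 => [|k /andP[ks kl]].
    rewrite sE in ls; have [-> ->] := Rintegral_spec ls ls.
    by rewrite eqxx mulr1 mulr0 !addr0.
  rewrite sE in ls ks; have [-> ->] := Rintegral_spec ks ls.
  by rewrite (negPf kl) !mulr0 addr0.
(* Used once with [(al, be)] and once with [(be, - al)], for the real and imaginary parts of the
   coefficient at [l]. *)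
have combine (a b : int -> R) (f : R -> R) :
    (forall x, f x = \sum_(k <- s) (a k * cos (2 * pi * (k%:~R - l%:~R) * x) +
      b k * sin (2 * pi * (k%:~R - l%:~R) * x))) -> I f = a l.
  move=> fE; have -> : f = (fun x => \sum_(k <- s) (a k * cos (2 * pi * (k%:~R - l%:~R) * x) +
      b k * sin (2 * pi * (k%:~R - l%:~R) * x))) by exact/funext.
  rewrite -[RHS](dual a b); have [k|_ ->] := Rintegral_sum s (F := fun (k : int) x =>
    a k * cos (2 * pi * (k%:~R - l%:~R) * x) + b k * sin (2 * pi * (k%:~R - l%:~R) * x)).
    by apply: integrD; exact: integrZ.
  apply: eq_bigr => k _; rewrite RintegralD//; [|exact: integrZ|exact: integrZ].
  by rewrite !RintegralZl.
rewrite (combine al be); last first.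
  move=> x; rewrite /p1 /p2 !mulr_suml -sumrB; apply: eq_bigr => k _.
  by rewrite csB snB; ring.
rewrite (combine be (fun k => - al k)) ?expr2// => x.
rewrite /p1 /p2 !mulr_suml -big_split; apply: eq_bigr => k _ /=.
by rewrite csB snB; ring.
Qed.

End Expansion.

Let kappa : R := pigap R ^+ 2 / 8.

Let integr_sq (u : R -> R) : measurable_fun setT u ->
  integr (fun x => u x ^+ 2) -> integr u.
Proof.
move=> mu' ui; have i1 : integr (fun x => 1 + u x ^+ 2).
  by apply: integrD => //; exact: (bdcont_integrable mu (bdcont_cst _)).
apply: le_integrable i1 => //; first exact/measurable_EFinP.
move=> x _; rewrite /= lee_fin [leRHS]ger0_norm ?addr_ge0 ?sqr_ge0//.
by rewrite ler_norml; apply/andP; split; have := sqr_ge0 (u x - 1);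
  have := sqr_ge0 (u x + 1); nra.
Qed.

(** Let [F], [G], [W] be the squared norms of [f = u + i v], of its approximation [g] and of
    [f - g], and [S] the sum of the squared coefficients of [g]. Then [F <= 2 G + 2 W],
    [kappa G <= S + d], [S <= W] and [W <= 2 d] combine to the constant [6 + 4 kappa]. *)
Lemma orthogonal_norm_small (u v : R -> R) (d : R) :
  measurable_fun setT u -> measurable_fun setT v ->
  integr (fun x => u x ^+ 2) -> integr (fun x => v x ^+ 2) ->
  (forall n l, l \in spec N L n ->
     I (fun x => u x * cs l x - v x * sn l x) = 0 /\
     I (fun x => u x * sn l x + v x * cs l x) = 0) ->
  0 < d -> kappa * I (fun x => u x ^+ 2 + v x ^+ 2) <= (6 + 4 * kappa) * d.
Proof.
move=> mu' mv iu2 iv2 orth d0.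
have [_ /(_ d d0)[g1 lg1 ug1]] := bdlip_dense mu' iu2.
have [_ /(_ d d0)[g2 lg2 vg2]] := bdlip_dense mv iv2.
have b1 := bdlip_bdcont lg1; have b2 := bdlip_bdcont lg2.
have iu := integr_sq mu' iu2; have iv := integr_sq mv iv2.
have ig1 := bdcont_integrable mu b1; have ig2 := bdcont_integrable mu b2.
have [n] := frame_limit N_ge2 size_B parsL cvg_bad muW gc_often lg1 lg2 d0.
pose al l := I (fun x => g1 x * cs l x - g2 x * sn l x).
pose be l := I (fun x => g1 x * sn l x + g2 x * cs l x).
rewrite -/(kappa); set G := I _; set S := \sum_(_ <- _) _ => GS.
pose s := spec N L n.
(* [p1 + i p2] is the orthogonal projection of [g] onto the span of the [e_l] with [l] in [s], so
   that [<g, p>] and the squared norm of [p] both equal [S]. *)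
pose p1 x := \sum_(l <- s) (al l * cs l x + be l * sn l x).
pose p2 x := \sum_(l <- s) (be l * cs l x - al l * sn l x).
have [iup Eup] : integr (fun x => u x * p1 x + v x * p2 x) /\
    I (fun x => u x * p1 x + v x * p2 x) = 0.
  have [i ->] := Rintegral_pairing s al be iu iv; split => //.
  rewrite big_seq big1// => l ls; have [-> ->] := orth n l ls.
  by rewrite !mulr0 addr0.
have [igp Egp] : integr (fun x => g1 x * p1 x + g2 x * p2 x) /\
    I (fun x => g1 x * p1 x + g2 x * p2 x) = S.
  have [i ->] := Rintegral_pairing s al be ig1 ig2; split => //.
have Epp : I (fun x => p1 x * p1 x + p2 x * p2 x) = S.
  exact: (Rintegral_expansion_norm al be (erefl s)).
have bp1 : bdcont p1.
  by apply: bdcont_sum => l; apply: bdcontD; apply: bdcontM => //; exact: bdcont_cst.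
have bp2 : bdcont p2.
  by apply: bdcont_sum => l; apply: bdcontB; apply: bdcontM => //; exact: bdcont_cst.
have ipp : integr (fun x => p1 x * p1 x + p2 x * p2 x).
  by apply: bdcont_integrable; apply: bdcontD; exact: bdcontM.
have sq_diff (w g : R -> R) : measurable_fun setT w -> integr w ->
    integr (fun x => w x ^+ 2) -> bdcont g ->
    (\int[mu]_x ((w \- g) x ^+ 2)%:E <= d%:E)%E ->
    integr (fun x => (w x - g x) ^+ 2) /\ I (fun x => (w x - g x) ^+ 2) <= d.
  move=> mw iw iw2 bg wg; have i : integr (fun x => (w x - g x) ^+ 2).
    have -> : (fun x => (w x - g x) ^+ 2) =
        fun x => (w x ^+ 2 - 2 * (w x * g x)) + g x ^+ 2.
      by apply/funext => x; ring.
    apply: integrD; last by apply: bdcont_integrable; exact: bdcontX2.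
    by apply: integrB => //; apply: integrZ; exact: integrable_bdcontM.
  by split => //; rewrite -lee_fin -integralE.
have [iD1 D1] := sq_diff _ _ mu' iu iu2 b1 ug1.
have [iD2 D2] := sq_diff _ _ mv iv iv2 b2 vg2.
pose D x := (u x - g1 x) ^+ 2 + (v x - g2 x) ^+ 2.
have iD : integr D by exact: integrD.
have DD : I D <= 2 * d by rewrite RintegralD//; lra.
(* Integrate [|f - g + p| ^ 2 >= 0], using that [f] is orthogonal to [p]. *)
have bessel : S <= I D.
  have : 0 <= I (fun x => D x + 2 * (u x * p1 x + v x * p2 x)
      - 2 * (g1 x * p1 x + g2 x * p2 x) + (p1 x * p1 x + p2 x * p2 x)).
    apply: Rintegral_ge0 => x _; rewrite /D.
    have := sqr_ge0 (u x - g1 x + p1 x); have := sqr_ge0 (v x - g2 x + p2 x); nra.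
  have i1 : integr (fun x => D x + 2 * (u x * p1 x + v x * p2 x)).
    by apply: integrD => //; exact: integrZ.
  rewrite RintegralD//; last by apply: integrB => //; exact: integrZ.
  rewrite RintegralB//; last exact: integrZ.
  rewrite RintegralD//; last exact: integrZ.
  by rewrite !RintegralZl// Eup Egp Epp; lra.
have iG : integr (fun x => g1 x ^+ 2 + g2 x ^+ 2).
  by apply: bdcont_integrable; apply: bdcontD; exact: bdcontX2.
have iF : integr (fun x => u x ^+ 2 + v x ^+ 2) by exact: integrD.
have FG : I (fun x => u x ^+ 2 + v x ^+ 2) <= 2 * G + 2 * I D.
  rewrite /G -!RintegralZl// -RintegralD//; [|exact: integrZ|exact: integrZ].
  apply: le_Rintegral => //; first by apply: integrD; exact: integrZ.
  move=> x _; rewrite /D.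
  have := sqr_ge0 (u x - 2 * g1 x); have := sqr_ge0 (v x - 2 * g2 x); nra.
have k0 : 0 <= kappa by rewrite divr_ge0 ?sqr_ge0.
move: FG GS bessel DD; set F := I _; set W := I D => FG GS bessel DD.
have : kappa * F <= kappa * (2 * G + 2 * W) by rewrite ler_wpM2l.
have : kappa * W <= kappa * (2 * d) by rewrite ler_wpM2l.
lra.
Qed.

Lemma weak_limit_spectral : spectral mu.
Proof.
(* The union of the increasing lists [spec N L n]: any two frequencies lie in a common list. *)
exists [set (l%:~R : R) | l in [set l : int | exists n, l \in spec N L n]].
split; first exact: (card_le_trans (card_image_le _ _) (countableP _)).
split.
  move=> _ _ [k [m km] <-] [l [n ln] <-].
  have kn := spec_sub N_gt0 L0 n km; have := spec_sub N_gt0 L0 m ln.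
  rewrite addnC => {}ln; have [C S] := Rintegral_spec kn ln.
  rewrite !integralE; try exact/bdcont_integrable/bdcont_cos;
    try exact/bdcont_integrable/bdcont_sin.
  by rewrite C S eqr_int; case: (k == l).
move=> u v mu' mv iu2 iv2 orth.
have iu := integr_sq mu' iu2; have iv := integr_sq mv iv2.
have orthI n l : l \in spec N L n ->
    I (fun x => u x * cs l x - v x * sn l x) = 0 /\
    I (fun x => u x * sn l x + v x * cs l x) = 0.
  move=> ln; have [|e1 e2] := orth l%:~R; first by exists l => //; exists n.
  by rewrite /Rintegral e1 e2.
have iF : integr (fun x => u x ^+ 2 + v x ^+ 2) by exact: integrD.
have k0 : 0 < kappa by rewrite divr_gt0 ?exprn_gt0 ?pigap_gt0.
have F0 : I (fun x => u x ^+ 2 + v x ^+ 2) = 0.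
  apply/eqP; rewrite eq_le; apply/andP; split; last first.
    by apply: Rintegral_ge0 => x _; rewrite addr_ge0 ?sqr_ge0.
  (* Taking [d = e / (6 + 4 kappa)] turns the bound into an arbitrary [e]. *)
  rewrite -(ler_pM2l k0) mulr0; apply/ler_addgt0Pl => e e0; rewrite addr0.
  have c0 : 0 < 6 + 4 * kappa by lra.
  rewrite -[e](@divfK _ (6 + 4 * kappa)) ?gt_eqF// [leRHS]mulrC.
  by apply: orthogonal_norm_small => //; exact: divr_gt0.
have mF : measurable_fun setT (fun x => (u x ^+ 2 + v x ^+ 2)%:E).
  exact: measurable_int iF.
have := (ae_eq_integral_abs mu measurableT mF).1.
rewrite (_ : (\int[mu]_x _)%E = 0%E); last first.
  under eq_integral => x _.
    rewrite gee0_abs; last by rewrite lee_fin addr_ge0 ?sqr_ge0.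
    over.
  by rewrite integralE// F0.
move=> /(_ erefl); apply: filterS => x Fx.
have [] : (u x ^+ 2 + v x ^+ 2)%:E = 0%E by exact: Fx.
move=> /eqP.
by rewrite paddr_eq0 ?sqr_ge0// !sqrf_eq0 => /andP[/eqP -> /eqP ->].
Qed.

End Spectrality.

(* Index shift: (N n, B n) is the paper's (N_{n+1}, B_{n+1}). *)
Theorem theorem2p2 (R : realType) (N : nat -> int) (B : nat -> seq int) :
  (forall n, admissible R (N n) (B n) /\ 0 < N n) ->
  (exists l : R, series (fun n : nat => ((card_B2 (N n) (B n))%:R / (size (B n))%:R : R)) @ \oo --> l) ->
  (exists nk : nat -> nat, (forall k, (nk k < nk k.+1)%N) /\
     (forall k, general_consecutive (N (nk k)) (B (nk k)))) ->
  exists mu : probability R R,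
    (forall f : R -> R, continuous f -> (exists M : R, forall x, `|f x| <= M) ->
       (fun n => (int_mu_n N B n f)%:E) @ \oo --> (\int[mu]_x (f x)%:E)%E)
    /\ spectral mu.
Proof.
move=> adm bad [nk [nk_incr gc]].
have N_ge2 n : 2 <= N n by have [[]] := adm n; lia.
have N_gt0 n : 0 < N n by case: (adm n).
have size_B n : (2 <= size (B n))%N by case: (adm n) => -[].
have B0 n : (0 < size (B n))%N by exact: leq_trans (size_B n).
have /choice[L HL] n : exists L, 0 \in L /\ parseval R (N n) (B n) L.
  by have [L L0 parsL] := admissible_parseval (adm n).1; exists L.
have gc_often n : exists2 k, (n <= k)%N & general_consecutive (N k) (B k).
  (* A strictly increasing sequence of indices satisfies [n <= nk n]. *)
  exists (nk n) => //; elim: n => // n IH; exact: leq_ltn_trans IH (nk_incr n).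
have [mu muE] := limit_measure_exists N_gt0 B0 bad.
exists mu; split; first by move=> f cf fM; exact: muE.
apply: (weak_limit_spectral (L := L) N_ge2 size_B) => //.
- by move=> n; case: (HL n).
- by move=> n; case: (HL n).
- move=> f bf; have := muE f bf.
  by rewrite (integralE (bdcont_integrable mu bf)) => /fine_cvg.
Qed.
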